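(* Let $K$ be a field containing $\mathbb{C}$, let $b=e^{4\pi i/3}$ and $c=\dfrac{2b^2}{1-b+b^2}$. Let $A$ be the quotient of the free algebra $K\langle x_1,x_2,x_3,x_4,x_5\rangle$, graded by $\deg(x_5)=\deg(x_4)=1$, $\deg(x_3)=2$, $\deg(x_2)=3$, $\deg(x_1)=5$, by the two-sided ideal generated by the relations \begin{align*} x_2x_1&=-x_1x_2, & x_3x_2&=x_1+b\,x_2x_3,\\ x_3x_1&=-x_1x_3, & x_4x_3&=x_2+b\,x_3x_4,\\ x_4x_2&=b^2x_2x_4, & x_4x_1&=x_1x_4,\\ x_5x_4&=x_3+x_4x_5, & x_5x_3&=-x_3x_5,\\ x_5x_2&=-x_2x_5-b^2x_3x_3, & x_5x_1&=x_1x_5+c\,x_3x_3x_3. \end{align*} Then $A$ is an AS-Ore extension (an iterated Ore extension in the variables $x_1,\dots,x_5$ which is graded, generated in degree one, and has each $\sigma_i$ injective), its Hilbert series is $$h_A(t)=\frac{1}{(1-t)^2(1-t^2)(1-t^3)(1-t^5)},$$ and its relation type is $(3,4,7)$.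
   Context: Let $K$ be a field. For a ring $R$, a ring endomorphism $\sigma$ of $R$ and a $\sigma$-derivation $\delta$ of $R$ (i.e. $\delta$ is additive and $\delta(r_1r_2)=\sigma(r_1)\delta(r_2)+\delta(r_1)r_2$), the Ore extension $R[x,\sigma,\delta]$ is the ring whose elements are written uniquely as $\sum_{i=0}^m a_ix^i$ with $a_i\in R$, with multiplication satisfying $xr=\sigma(r)x+\delta(r)$ for $r\in R$. A graded iterated Ore extension over $K$ in $n$ variables is a $K$-algebra (so $K$ is central) $A=K[x_1][x_2,\sigma_2,\delta_2]\cdots[x_n,\sigma_n,\delta_n]$ obtained by iterating this construction, where $\sigma_j$ and $\delta_j$ are a ($K$-linear) endomorphism and a ($K$-linear) $\sigma_j$-derivation of $K_{(j-1)}:=K[x_1][x_2,\sigma_2,\delta_2]\cdots[x_{j-1},\sigma_{j-1},\delta_{j-1}]$, together with integers $\deg(x_i)\ge 1$ such that for all $j>i$, $\sigma_j(x_i)$ is homogeneous of degree $\deg(x_i)$ and $\delta_j(x_i)$ is homogeneous of degree $\deg(x_j)+\deg(x_i)$ (with $0$ homogeneous of every degree). Such $A$ is $\mathbb{N}$-graded and connected. An AS-Ore extension is a graded iterated Ore extension in which every $\sigma_j$ is injective and which is generated in degree one as a $K$-algebra. The Hilbert series of $A=\bigoplus_m A_m$ is $h_A(t)=\sum_m(\dim_K A_m)t^m$. Relation type: write $A\cong K\langle y_1,\dots,y_b\rangle/I$ with all $y_i$ of degree one, $b=\dim_K A_1$, and $I$ a homogeneous two-sided ideal. The relation type of $A$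 is the list $(a_1,\dots,a_n)$, $a_1\le\cdots\le a_n$, of the degrees of the elements of a minimal homogeneous generating set of $I$ (independent of choices). *)

(* Defs.v *)
From HB Require Import structures.
From mathcomp Require Import all_boot all_order all_algebra.
From mathcomp Require Import complex.
From mathcomp Require Import boolp classical_sets functions reals.
From mathcomp Require Import sequences trigo.
From mathcomp.multinomials Require Import monalg.

Set Implicit Arguments.
Unset Strict Implicit.
Unset Printing Implicit Defensive.

Import GRing.Theory.

Local Open Scope ring_scope.
Local Open Scope quotient_scope.
Local Open Scope classical_set_scope.

Definition lin_span (K : fieldType) (V : lmodType K) (G : set V) : set V :=
  smallest (fun S : set V => GRing.submod_closed [in S]) G.

Definition subalgebra_gen (K : fieldType) (A : algType K) (G : set A) : set A :=
  smallest (fun S : set A => GRing.subalg_closed [in S]) G.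

Definition ideal_closed (F : nzRingType) (S : set F) : Prop :=
  [/\ S 0,
      forall x y, S x -> S y -> S (x - y) &
      forall a x b, S x -> S (a * x * b)].

Definition ideal_gen (F : nzRingType) (G : set F) : set F :=
  smallest (@ideal_closed F) G.

Lemma ideal_gen_closed (F : nzRingType) (G : set F) :
  ideal_closed (ideal_gen G).
Proof.
split=> [S [[]] // | x y Ix Iy S SG | a x b Ix S SG].
- by case: (SG) => [[_ SB _] _]; apply: SB; [apply: Ix | apply: Iy].
- by case: (SG) => [[_ _ SM] _]; apply: SM; apply: Ix.
Qed.

Definition has_dim (K : fieldType) (V : lmodType K) (S : set V) (k : nat) :
    Prop :=
  exists v : 'I_k -> V,
    lin_span (range v) = S /\
    (forall a : 'I_k -> K, \sum_i a i *: v i = 0 -> forall i, a i = 0).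

(** [algType] excludes the zero algebra, so only proper ideals are allowed. *)
Record proper_ideal (F : nzRingType) := ProperIdeal {
  ideal_set : set F;
  ideal_setP : ideal_closed ideal_set;
  ideal_set1 : ~ ideal_set 1
}.

Section Quotient.
Variables (K : fieldType) (F : algType K) (I : proper_ideal F).

Lemma ideal0 : ideal_set I 0. Proof. by case: (ideal_setP I). Qed.

Lemma idealB x y : ideal_set I x -> ideal_set I y -> ideal_set I (x - y).
Proof. by case: (ideal_setP I) => _ IB _; apply: IB. Qed.

Lemma idealN x : ideal_set I x -> ideal_set I (- x).
Proof. by rewrite -[- x]sub0r; apply: idealB ideal0. Qed.

Lemma idealD x y : ideal_set I x -> ideal_set I y -> ideal_set I (x + y).
Proof. by move=> Ix Iy; rewrite -[y]opprK; apply: idealB (idealN Iy). Qed.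

Lemma idealMl a x : ideal_set I x -> ideal_set I (a * x).
Proof.
by case: (ideal_setP I) => _ _ IM Ix; rewrite -[a * x]mulr1; apply: IM.
Qed.

Lemma idealMr a x : ideal_set I x -> ideal_set I (x * a).
Proof.
by case: (ideal_setP I) => _ _ IM Ix; rewrite -[x]mul1r; apply: IM.
Qed.

Lemma idealZ k x : ideal_set I x -> ideal_set I (k *: x).
Proof. by move=> Ix; rewrite -[x]mul1r scalerAl; apply: idealMl. Qed.

Definition ideal_rel (x y : F) : bool := `[< ideal_set I (x - y) >].

Fact ideal_rel_equiv : equiv_class_of ideal_rel.
Proof.
split=> [x | x y | y x z].
- by apply/asboolP; rewrite subrr; apply: ideal0.
- by apply/asboolP/asboolP => /idealN; rewrite opprB.
- move=> /asboolP Ixy /asboolP Iyz; apply/asboolP.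
  by rewrite -[x](subrK y) -addrA; apply: idealD.
Qed.

Canonical ideal_equiv := EquivRelPack ideal_rel_equiv.
Canonical ideal_encModRel := defaultEncModRel ideal_rel.

Definition quot_alg := {eq_quot ideal_rel}.

HB.instance Definition _ : EqQuotient F ideal_rel quot_alg :=
  EqQuotient.on quot_alg.
HB.instance Definition _ := Choice.on quot_alg.

Definition quot_pi (x : F) : quot_alg := \pi_quot_alg x.

Lemma quot_piP x y : quot_pi x = quot_pi y <-> ideal_set I (x - y).
Proof.
by split=> [/eqP | Ixy]; [rewrite piE => /asboolP | apply/eqP; rewrite piE;
  apply/asboolP].
Qed.

Lemma quot_piK (u : quot_alg) : quot_pi (repr u) = u.
Proof. exact: reprK. Qed.

Let rep x : ideal_set I (repr (quot_pi x) - x).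
Proof. by apply/quot_piP; rewrite quot_piK. Qed.

Definition qzero : quot_alg := quot_pi 0.
Definition qone : quot_alg := quot_pi 1.
Definition qopp (u : quot_alg) : quot_alg := quot_pi (- repr u).
Definition qadd (u v : quot_alg) : quot_alg := quot_pi (repr u + repr v).
Definition qmul (u v : quot_alg) : quot_alg := quot_pi (repr u * repr v).
Definition qscale (k : K) (u : quot_alg) : quot_alg := quot_pi (k *: repr u).

Lemma qoppE x : qopp (quot_pi x) = quot_pi (- x).
Proof. by apply/quot_piP; rewrite -opprD; apply/idealN/rep. Qed.

Lemma qaddE x y : qadd (quot_pi x) (quot_pi y) = quot_pi (x + y).
Proof. by apply/quot_piP; rewrite opprD addrACA; apply: idealD; apply: rep. Qed.

Lemma qmulE x y : qmul (quot_pi x) (quot_pi y) = quot_pi (x * y).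
Proof.
apply/quot_piP; set x' := repr _; set y' := repr _.
have -> : x' * y' - x * y = (x' - x) * y' + x * (y' - y).
  by rewrite mulrBl mulrBr addrA subrK.
by apply: idealD; [apply/idealMr/rep | apply/idealMl/rep].
Qed.

Lemma qscaleE k x : qscale k (quot_pi x) = quot_pi (k *: x).
Proof. by apply/quot_piP; rewrite -scalerBr; apply/idealZ/rep. Qed.

Let qE := (qoppE, qaddE, qmulE, qscaleE).

Let qP (P : quot_alg -> Prop) : (forall x, P (quot_pi x)) -> forall u, P u.
Proof. by move=> Ppi u; rewrite -(quot_piK u). Qed.

Fact qaddA : associative qadd.
Proof. by elim/qP=> x; elim/qP=> y; elim/qP=> z; rewrite !qE addrA. Qed.
Fact qaddC : commutative qadd.
Proof. by elim/qP=> x; elim/qP=> y; rewrite !qE addrC. Qed.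
Fact qadd0 : left_id qzero qadd.
Proof. by elim/qP=> x; rewrite !qE add0r. Qed.
Fact qaddN : left_inverse qzero qopp qadd.
Proof. by elim/qP=> x; rewrite !qE addNr. Qed.

HB.instance Definition _ := GRing.isZmodule.Build quot_alg
  qaddA qaddC qadd0 qaddN.

Fact qmulA : associative qmul.
Proof. by elim/qP=> x; elim/qP=> y; elim/qP=> z; rewrite !qE mulrA. Qed.
Fact qmul1l : left_id qone qmul.
Proof. by elim/qP=> x; rewrite !qE mul1r. Qed.
Fact qmul1r : right_id qone qmul.
Proof. by elim/qP=> x; rewrite !qE mulr1. Qed.
Fact qmulDl : left_distributive qmul +%R.
Proof.
by elim/qP=> x; elim/qP=> y; elim/qP=> z; rewrite /+%R/= !qE mulrDl.
Qed.
Fact qmulDr : right_distributive qmul +%R.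
Proof.
by elim/qP=> x; elim/qP=> y; elim/qP=> z; rewrite /+%R/= !qE mulrDr.
Qed.
Fact qone_neq0 : qone != 0.
Proof. by apply/eqP => /quot_piP; rewrite subr0; apply: ideal_set1. Qed.

HB.instance Definition _ := GRing.Zmodule_isNzRing.Build quot_alg
  qmulA qmul1l qmul1r qmulDl qmulDr qone_neq0.

Fact qscaleA a b u : qscale a (qscale b u) = qscale (a * b) u.
Proof. by elim/qP: u => x; rewrite !qE scalerA. Qed.
Fact qscale1 : left_id 1 qscale.
Proof. by elim/qP=> x; rewrite !qE scale1r. Qed.
Fact qscaleDr : right_distributive qscale +%R.
Proof. by move=> k; elim/qP=> x; elim/qP=> y; rewrite /+%R/= !qE scalerDr. Qed.
Fact qscaleDl u : {morph qscale^~ u : a b / a + b}.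
Proof. by elim/qP: u => x a b; rewrite [RHS]/+%R/= !qE scalerDl. Qed.

HB.instance Definition _ := GRing.Zmodule_isLmodule.Build K quot_alg
  qscaleA qscale1 qscaleDr qscaleDl.

Fact qscaleAl k (u v : quot_alg) : k *: (u * v) = (k *: u) * v.
Proof.
by elim/qP: u => x; elim/qP: v => y; rewrite /*:%R/= /*%R/= !qE scalerAl.
Qed.
HB.instance Definition _ := GRing.Lmodule_isLalgebra.Build K quot_alg qscaleAl.

Fact qscaleAr k (u v : quot_alg) : k *: (u * v) = u * (k *: v).
Proof.
by elim/qP: u => x; elim/qP: v => y; rewrite /*:%R/= /*%R/= !qE scalerAr.
Qed.
HB.instance Definition _ := GRing.Lalgebra_isAlgebra.Build K quot_alg qscaleAr.

Fact quot_pi_zmod_morphism : zmod_morphism quot_pi.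
Proof. by move=> x y; rewrite /+%R/= /-%R/= !qE. Qed.
Fact quot_pi_monoid_morphism : monoid_morphism quot_pi.
Proof. by split=> // x y; rewrite /*%R/= !qE. Qed.
Fact quot_pi_scalable : scalable quot_pi.
Proof. by move=> k x; rewrite /*:%R/= !qE. Qed.

HB.instance Definition _ :=
  GRing.isZmodMorphism.Build F quot_alg quot_pi quot_pi_zmod_morphism.
HB.instance Definition _ :=
  GRing.isMonoidMorphism.Build F quot_alg quot_pi quot_pi_monoid_morphism.
HB.instance Definition _ :=
  GRing.isScalable.Build K F quot_alg *:%R quot_pi quot_pi_scalable.

End Quotient.

Definition free_alg (K : fieldType) (n : nat) := {malg K[{fmonom 'I_n}]}.

HB.instance Definition _ (K : fieldType) n := GRing.Lalgebra.on (free_alg K n).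

Fact malg_scaleAr (K : fieldType) (M : monomType) (k : K) (f g : {malg K[M]}) :
  k *: (f * g) = f * (k *: g).
Proof.
apply/malgP => m; rewrite mcoeffZ mcoeffMl.
rewrite (mcoeffMlw m (finmap.fsubset_refl _) (msuppZ_le k g)).
rewrite mulr_sumr; apply: eq_bigr => m1 _.
rewrite mulr_sumr; apply: eq_bigr => m2 _.
by rewrite mulrnAr mcoeffZ mulrCA.
Qed.

HB.instance Definition _ (K : fieldType) n :=
  GRing.Lalgebra_isAlgebra.Build K (free_alg K n) (@malg_scaleAr K _).

Definition free_gen (K : fieldType) (n : nat) (i : 'I_n) : free_alg K n :=
  << fmu i >>.

(** The [m]-th component of the grading for which the elements [y.1] have degree
    [y.2], where [y] ranges over [g]: the span of the words of weight [m]. *)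
Definition hcomp (K : fieldType) (A : algType K) (g : seq (A * nat)) (m : nat) :
    set A :=
  lin_span [set \prod_(y <- w) y.1 | w in
    [set w : seq (A * nat) | {subset w <= g} /\ (\sum_(y <- w) y.2)%N = m]].

Definition is_grading (K : fieldType) (A : algType K) (A_ : nat -> set A) :
    Prop :=
  [/\ forall m, GRing.submod_closed [in A_ m],
      A_ 0%N 1,
      forall i j a b, A_ i a -> A_ j b -> A_ (i + j)%N (a * b) &
      (* finitely supported families of elements of [A] are encoded as
         elements of [{poly A}] *)
      forall a, exists! p : {poly A},
        (forall m, A_ m p`_m) /\ a = \sum_(m < size p) p`_m].

Definition hilbert_series (K : fieldType) (A : algType K) (A_ : nat -> set A)
    (h : nat -> nat) : Prop :=
  is_grading A_ /\ forall m, has_dim (A_ m) (h m).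

(** The power series with coefficients [h] equals [1 / p] in [Z[[t]]]. *)
Definition fps_eq_inv (h : nat -> nat) (p : {poly int}) : Prop :=
  forall m : nat, \sum_(i < m.+1) p`_i * (h (m - i)%N)%:Z = (m == 0%N)%:R.

(** [S = R[x; sigma, delta]], with [iota] the inclusion of [R]. *)
Definition is_ore_ext (K : fieldType) (R S : algType K)
    (iota : {lrmorphism R -> S}) (x : S)
    (sigma : {lrmorphism R -> R}) (delta : {linear R -> R}) : Prop :=
  [/\ forall r1 r2, delta (r1 * r2) = sigma r1 * delta r2 + delta r1 * r2,
      forall r, x * iota r = iota (sigma r) * x + iota (delta r) &
      forall s, exists! p : {poly R}, s = \sum_(i < size p) iota p`_i * x ^+ i].

(** Over [K] itself, [sigma] is the identity and [delta] is zero, so the first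
    step gives [K[x_1]]. *)
Inductive ore_tower (K : fieldType) : algType K -> Type :=
| OreBase : ore_tower K^o
| OreStep (R S : algType K) (T : ore_tower R)
    (iota : {lrmorphism R -> S}) (x : S)
    (sigma : {lrmorphism R -> R}) (delta : {linear R -> R}) :
    is_ore_ext iota x sigma delta -> ore_tower S.

Fixpoint ore_vars (K : fieldType) (A : algType K) (T : ore_tower A) : seq A :=
  match T in ore_tower A return seq A with
  | OreBase => [::]
  | OreStep _ _ T' iota x _ _ _ => rcons (map iota (ore_vars T')) x
  end.

Fixpoint ore_injective (K : fieldType) (A : algType K) (T : ore_tower A) :
    Prop :=
  match T with
  | OreBase => True
  | OreStep _ _ T' _ _ sigma _ _ => ore_injective T' /\ injective sigma
  end.

(** The [i]-th variable has degree [d`_i]. [zip] truncates, so that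
    [zip (ore_vars T') d] lists the variables of [T'] with their degrees. *)
Fixpoint ore_graded (K : fieldType) (d : seq nat) (A : algType K)
    (T : ore_tower A) : Prop :=
  match T with
  | OreBase => True
  | OreStep _ _ T' _ _ sigma delta _ =>
      let g := zip (ore_vars T') d in
      let e := nth 0%N d (size (ore_vars T')) in
      [/\ ore_graded d T', (1 <= e)%N &
          forall y, y \in g ->
            hcomp g y.2 (sigma y.1) /\ hcomp g (e + y.2)%N (delta y.1)]
  end.

Definition AS_ore_extension (K : fieldType) (A : algType K)
    (x : seq A) (d : seq nat) : Prop :=
  exists T : ore_tower A,
    [/\ ore_vars T = x, size d = size x, ore_graded d T, ore_injective T &
        subalgebra_gen (hcomp (zip x d) 1) = setT].

Definition std_comp (K : fieldType) (b m : nat) : set (free_alg K b) :=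
  hcomp [seq (free_gen K i, 1%N) | i <- enum 'I_b] m.

Definition min_hgens (K : fieldType) (b : nat) (I : set (free_alg K b))
    (r : seq (free_alg K b)) (s : seq nat) : Prop :=
  [/\ uniq r, size s = size r,
      forall i, (i < size r)%N -> std_comp (nth 0%N s i) (nth 0 r i),
      ideal_gen [set` r] = I &
      forall G, G `<` [set` r] -> ideal_gen G <> I].

Definition relation_type (K : fieldType) (A : algType K) (A_ : nat -> set A)
    (s : seq nat) : Prop :=
  sorted leq s /\
  exists (b : nat) (I : proper_ideal (free_alg K b))
      (psi : {lrmorphism quot_alg I -> A}) (r : seq (free_alg K b)),
    [/\ has_dim (A_ 1%N) b, bijective psi,
        forall i, A_ 1%N (psi (quot_pi I (free_gen K i))) &
        min_hgens (ideal_set I) r s].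

Definition cexp (R : realType) (z : R[i]) : R[i] :=
  let: (x +i* y)%C := z in ((expR x * cos y) +i* (expR x * sin y))%C.

Section Example.
Variables (K : fieldType) (b c : K).

Definition ex_relations : seq (free_alg K 5) :=
  let x1 := free_gen K (@Ordinal 5 0 isT) in
  let x2 := free_gen K (@Ordinal 5 1 isT) in
  let x3 := free_gen K (@Ordinal 5 2 isT) in
  let x4 := free_gen K (@Ordinal 5 3 isT) in
  let x5 := free_gen K (@Ordinal 5 4 isT) in
  [:: x2 * x1 - (- (x1 * x2));
      x3 * x2 - (x1 + b *: (x2 * x3));
      x3 * x1 - (- (x1 * x3));
      x4 * x3 - (x2 + b *: (x3 * x4));
      x4 * x2 - b ^+ 2 *: (x2 * x4);
      x4 * x1 - x1 * x4;
      x5 * x4 - (x3 + x4 * x5);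
      x5 * x3 - (- (x3 * x5));
      x5 * x2 - (- (x2 * x5) - b ^+ 2 *: (x3 * x3));
      x5 * x1 - (x1 * x5 + c *: (x3 * x3 * x3))].

Fact ex_ideal1 : ~ ideal_gen [set` ex_relations] 1.
Proof.
have [e [[e1 eD eN] [eZ eM eX]]] : exists e : free_alg K 5 -> K,
    [/\ e 1 = 1, {morph e : f g / f + g} & {morph e : f / - f}] /\
    [/\ forall k f, e (k *: f) = k * e f, {morph e : f g / f * g} &
        forall i, e (free_gen K i) = 0].
  exists (@mcoeff {fmonom 'I_5} K (@mone _)); split; split.
  - by rewrite mcoeff1 eqxx.
  - exact: mcoeffD.
  - exact: mcoeffN.
  - by move=> k f; apply: mcoeffZ.
  - by case: (@mcoeff1g_is_multiplicative {fmonom 'I_5} K).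
  - by move=> i; rewrite /free_gen mcoeffU1 -val_eqE /= fmU fm1.
move=> /(_ [set f | e f = 0]) /= I1.
suff : e 1 = 0 by rewrite e1 => /eqP; rewrite oner_eq0.
apply: I1; split; first split => /=.
- by rewrite -(subrr 1) eD eN subrr.
- by move=> f g ef eg; rewrite eD eN ef eg subrr.
- by move=> a f a' ef; rewrite !eM ef mulr0 mul0r.
move=> f /=; rewrite /ex_relations !inE => Hf.
do ?[case/predU1P: Hf => [->|Hf]]; last move/eqP: Hf => ->.
all: by rewrite ?(eD, eN, eZ, eM, eX, mulr0, addr0, oppr0).
Qed.

Definition ex_ideal : proper_ideal (free_alg K 5) :=
  ProperIdeal (ideal_gen_closed [set` ex_relations]) ex_ideal1.

End Example.

(* Main.v *)
Require Import Defs.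
From HB Require Import structures.
From mathcomp Require Import all_boot all_order all_algebra.
From mathcomp Require Import complex.
From mathcomp Require Import boolp classical_sets.
From mathcomp Require Import reals sequences exp trigo.
From mathcomp.multinomials Require Import monalg.
From mathcomp Require Import ring lra.

Set Implicit Arguments.
Unset Strict Implicit.
Unset Printing Implicit Defensive.

Import GRing.Theory.

Local Open Scope ring_scope.
Local Open Scope classical_set_scope.

(** The number [b] is a primitive cube root of unity, so that
    [b^2 + b + 1 = 0], and then [c = - b]. All coefficients of the relations are
    Eisenstein integers, and only this equation and the invertibility of [2],
    which turns the given fraction into [- b], matter.

    Each relation has the form [x_j x_i = kappa x_i x_j + tail] with [i < j],
    where [kappa] is a unit and [tail] involves only variables before [x_j].
    This prescribes an endomorphism [sigma_j], diagonal on the variables, and a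
    [sigma_j]-derivation [delta_j] by their values on the variables. That they
    exist is the point to prove. A pair [(sigma, delta)] on [R] is the same as
    a morphism from [R] to upper triangular matrices of size two
    ([tri_skew]). If [R] is known by generators and relations, such a morphism
    exists once the images of the generators satisfy the relations, a finite
    check done by computing with noncommutative polynomials
    ([table_compatible]). By the universal property of Ore extensions
    ([ore_lift]), the extension is again known by generators and relations, and
    the construction goes on ([ore_step]). The final tower has the same
    presentation as [A], hence is isomorphic to it ([ex_tower]). Each [sigma_j]
    has finite order, hence is injective.

    In a graded Ore extension with variable [x] of degree [e], pushing [x] to
    the right preserves degrees, so an element is homogeneous exactly when its
    coefficients are ([hcomp_ore]). This gives
    [S_m = R_m (+) S_(m - e) x], and by induction the Hilbert series of a graded
    tower is the product of the [1 / (1 - t^(d_i))] ([ore_tower_hilbert]).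

    The relations for [x5 x4], [x4 x3] and [x3 x2] express [x3], [x2] and [x1] as
    iterated brackets of [x4] and [x5], so [A] is generated in degree one, and
    its component of degree one has dimension two. After elimination, the
    relations for [x5 x3], [x4 x2] and [x3 x1], of degrees [3], [4] and [7],
    imply the remaining four ([gen_env_satisfies]). In terms of [x = x4] and
    [y = x5], the first two are [y^2 x - x y^2] and [y x^3 - x^3 y]. None of the
    three is redundant: each has a nonzero coefficient at a word of which no
    factor is a monomial of the other two ([witness_check]), whereas the
    polynomials without monomials among the factors of a fixed word form an
    ideal ([infix_free_ideal]). *)

(** * Triangular matrices and skew derivations *)
Lemma lrmorphism_exists (K : fieldType) (A B : algType K) (f : A -> B) :
  linear f -> f 1 = 1 -> {morph f : u v / u * v} ->
  exists F : {lrmorphism A -> B}, F =1 f.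
Proof.
move=> fL f1 fM.
pose fl := GRing.isLinear.Build K A B *:%R f fL.
pose fm := GRing.isMonoidMorphism.Build A B f (conj f1 fM).
pose F : {lrmorphism A -> B} := HB.pack f fl fm.
by exists F.
Qed.

Lemma linear_exists (K : fieldType) (U V : lmodType K) (f : U -> V) :
  linear f -> exists F : {linear U -> V}, F =1 f.
Proof.
move=> fL; pose fl := GRing.isLinear.Build K U V *:%R f fL.
pose F : {linear U -> V} := HB.pack f fl.
by exists F.
Qed.

Section Triangular.
Variables (K : fieldType) (S : algType K).

(** The triple [(s, d, t)] stands for the matrix with rows [(s, d)] and [(0, t)].
    An algebra morphism [r |-> (sigma r, delta r, r)] into such matrices is the
    same thing as a ring endomorphism [sigma] together with a
    [sigma]-derivation [delta]: the corner of a product of two images is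
    [sigma r1 * delta r2 + delta r1 * r2].  A universal property of [R] thus
    yields skew derivations of [R]. *)
Definition tri : Type := (S * S * S)%type.

HB.instance Definition _ := GRing.Lmodule.on tri.

Definition tri_one : tri := (1, 0, 1).
Definition tri_mul (u v : tri) : tri :=
  (u.1.1 * v.1.1, u.1.1 * v.1.2 + u.1.2 * v.2, u.2 * v.2).

Fact tri_mulA : associative tri_mul.
Proof.
move=> u v w; rewrite /tri_mul /= !mulrA.
by rewrite mulrDr mulrDl !mulrA addrA.
Qed.
Fact tri_mul1l : left_id tri_one tri_mul.
Proof. by move=> [[s d] t]; rewrite /tri_mul /= !mul1r mul0r addr0. Qed.
Fact tri_mul1r : right_id tri_one tri_mul.
Proof. by move=> [[s d] t]; rewrite /tri_mul /= !mulr1 mulr0 add0r. Qed.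
Fact tri_mulDl : left_distributive tri_mul +%R.
Proof.
by move=> u v w; rewrite /tri_mul /= !mulrDl addrACA.
Qed.
Fact tri_mulDr : right_distributive tri_mul +%R.
Proof. by move=> u v w; rewrite /tri_mul /= !mulrDr addrACA. Qed.
Fact tri_one_neq0 : tri_one != 0.
Proof. by apply/eqP => /(congr1 snd) /eqP; rewrite oner_eq0. Qed.

HB.instance Definition _ := GRing.Zmodule_isNzRing.Build tri
  tri_mulA tri_mul1l tri_mul1r tri_mulDl tri_mulDr tri_one_neq0.

Fact tri_eq (u v : tri) :
  u.1.1 = v.1.1 -> u.1.2 = v.1.2 -> u.2 = v.2 -> u = v.
Proof. by case: u v => [[? ?] ?] [[? ?] ?] /= -> -> ->. Qed.

Fact tri_scaleAl k (u v : tri) : k *: (u * v) = (k *: u : tri) * v.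
Proof. apply: tri_eq; [exact: scalerAl| |exact: scalerAl].
by rewrite [LHS]scalerDr !scalerAl. Qed.
HB.instance Definition _ := GRing.Lmodule_isLalgebra.Build K tri tri_scaleAl.

Fact tri_scaleAr k (u v : tri) : k *: (u * v) = u * (k *: v : tri).
Proof. apply: tri_eq; [exact: scalerAr| |exact: scalerAr].
by rewrite [LHS]scalerDr !scalerAr. Qed.
HB.instance Definition _ := GRing.Lalgebra_isAlgebra.Build K tri tri_scaleAr.

End Triangular.

Lemma tri_skew (K : fieldType) (R S : algType K) (F : {lrmorphism R -> tri S}) :
  exists (s t : {lrmorphism R -> S}) (d : {linear R -> S}),
    [/\ forall r, F r = (s r, d r, t r) &
        forall r1 r2, d (r1 * r2) = s r1 * d r2 + d r1 * t r2].
Proof.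
have [s sE] : exists s : {lrmorphism R -> S}, s =1 (fun r => (F r).1.1).
  by apply: lrmorphism_exists => [k u v||u v];
     rewrite ?linearP ?rmorph1 ?rmorphM.
have [t tE] : exists t : {lrmorphism R -> S}, t =1 (fun r => (F r).2).
  by apply: lrmorphism_exists => [k u v||u v];
     rewrite ?linearP ?rmorph1 ?rmorphM.
have [d dE] : exists d : {linear R -> S}, d =1 (fun r => (F r).1.2).
  by apply: linear_exists => k u v; rewrite linearP.
exists s, t, d; split=> [r|r1 r2]; rewrite !dE sE tE.
  by case: (F r) => [[]].
by rewrite rmorphM.
Qed.

(** * Twisted evaluation of polynomials *)
Section TwistedEvaluation.
Variables (K : fieldType) (R : algType K).

(** Left multiplication by the variable, on coefficients: in an Ore extension,
    [x * (a * x ^+ i) = sigma a * x ^+ i.+1 + delta a * x ^+ i]. *)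
Definition skew_shift (sigma delta : R -> R) (p : {poly R}) : {poly R} :=
  map_poly sigma p * 'X + map_poly delta p.

Definition skew_eval (B : algType K) (f : R -> B) (y : B) (p : {poly R}) : B :=
  \sum_(i < size p) f p`_i * y ^+ i.

Variables (sigma : {lrmorphism R -> R}) (delta : {linear R -> R}).
Hypothesis deltaM :
  forall r1 r2, delta (r1 * r2) = sigma r1 * delta r2 + delta r1 * r2.

Local Notation T := (skew_shift sigma delta).

Lemma skew_der1 : delta 1 = 0.
Proof.
have := deltaM 1 1; rewrite rmorph1 !mulr1 mul1r => d1.
by apply: (addrI (delta 1)); rewrite addr0 -d1.
Qed.

Lemma coef_shift p i :
  (T p)`_i = (if i is j.+1 then sigma p`_j else 0) + delta p`_i.
Proof.
by rewrite coefD coefMX !coef_map_id0 ?linear0 //; case: i.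
Qed.

Lemma shiftB : zmod_morphism T.
Proof. by move=> p q; rewrite /skew_shift !raddfB /= mulrBl addrACA opprD. Qed.

HB.instance Definition _ := GRing.isZmodMorphism.Build {poly R} {poly R} T shiftB.

Lemma shiftZ a p : T (a *: p) = sigma a *: T p + delta a *: p.
Proof.
apply/polyP => i; rewrite [RHS]coefD !coefZ !coef_shift !coefZ deltaM.
by case: i => [|i]; rewrite ?coefZ ?rmorphM !mulrDr ?addrA ?mulr0 ?add0r.
Qed.

Lemma shiftXn i : T 'X^i = 'X^(i.+1).
Proof.
apply/polyP=> j; rewrite coef_shift !coefXn; case: j => [|j].
  by case: (_ == _); rewrite ?skew_der1 ?linear0 addr0.
rewrite !coefXn eqSS; case: (j == i); case: (_ == i);
  by rewrite ?rmorph1 ?rmorph0 ?skew_der1 ?linear0 ?addr0.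
Qed.

Section Eval.
Variables (B : algType K) (f : {lrmorphism R -> B}) (y : B).
Local Notation E := (skew_eval f y).

Lemma skew_evalE n (p : {poly R}) : (size p <= n)%N -> E p = \sum_(i < n) f p`_i * y ^+ i.
Proof.
move=> pn; rewrite /skew_eval.
rewrite (big_ord_widen n (fun i => f p`_i * y ^+ i) pn) big_mkcond.
apply: eq_bigr => i _; case: ltnP => // pi.
by rewrite nth_default // rmorph0 mul0r.
Qed.

Lemma skew_evalB : zmod_morphism E.
Proof.
move=> p q; set n := maxn (size p) (size q).
rewrite !(@skew_evalE n) ?leq_maxl ?leq_maxr //; last first.
  by rewrite (leq_trans (size_polyD _ _)) // size_polyN.
by rewrite -sumrB; apply: eq_bigr => i _; rewrite coefB rmorphB mulrBl.
Qed.

HB.instance Definition _ := GRing.isZmodMorphism.Build {poly R} B E skew_evalB.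

Lemma skew_evalZ a p : E (a *: p) = f a * E p.
Proof.
rewrite (@skew_evalE (size p)) ?size_scale_leq // mulr_sumr.
by apply: eq_bigr => i _; rewrite coefZ rmorphM mulrA.
Qed.

Lemma skew_evalXn i : E 'X^i = y ^+ i.
Proof.
rewrite (@skew_evalE i.+1) ?size_polyXn // big_ord_recr /= big1 => [|j _].
  by rewrite coefXn eqxx rmorph1 mul1r add0r.
by rewrite coefXn ltn_eqF // rmorph0 mul0r.
Qed.

Lemma skew_evalC a : E a%:P = f a.
Proof. by rewrite -alg_polyC skew_evalZ -(expr0 'X) skew_evalXn mulr1. Qed.

Hypothesis yf : forall r, y * f r = f (sigma r) * y + f (delta r).

(** Evaluation carries the formal multiplication by the variable to the
    multiplication by [y] as soon as [y] obeys the commutation rule of the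
    variable. The universal property of Ore extensions rests on this. *)
Lemma skew_eval_shift p : E (T p) = y * E p.
Proof.
have sT : (size (T p) <= (size p).+1)%N.
  apply/leq_sizeP => [[|i]] // pi; rewrite coef_shift !nth_default ?rmorph0 //.
  - by rewrite linear0 addr0.
  - exact: ltnW.
rewrite (skew_evalE sT) (skew_evalE (leqnSn _)) mulr_sumr.
under eq_bigr do rewrite coef_shift rmorphD mulrDl.
under [RHS]eq_bigr do rewrite mulrA yf mulrDl -mulrA -exprS.
rewrite !big_split /=; congr (_ + _).
rewrite big_ord_recl [RHS]big_ord_recr /= rmorph0 mul0r add0r.
rewrite nth_default // rmorph0 rmorph0 mul0r addr0.
by apply: eq_bigr.
Qed.

End Eval.
End TwistedEvaluation.

(** * Existence of Ore extensions *)
Record skew_derivation (K : fieldType) (R : algType K) := SkewDerivation {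
  sk_sigma : {lrmorphism R -> R};
  sk_delta : {linear R -> R};
  sk_deltaM : forall r1 r2,
    sk_delta (r1 * r2) = sk_sigma r1 * sk_delta r2 + sk_delta r1 * r2
}.

(** The twisted product on polynomials depends on [D], so [D] must appear in the
    name of the carrier for instance resolution to find it. *)
Definition ore_algebra (K : fieldType) (R : algType K)
  (D : skew_derivation R) : Type := {poly R}.

Section OrePoly.
Variables (K : fieldType) (R : algType K) (D : skew_derivation R).

Local Notation sigma := (sk_sigma D).
Local Notation delta := (sk_delta D).
Local Notation T := (skew_shift sigma delta).

Local Notation ore_poly := (ore_algebra D).

HB.instance Definition _ := GRing.Zmodule.on ore_poly.

(** The variable acts on the right factor by [T], hence [x ^+ i] by its iterates:
    no formula for the coefficients of [x ^+ i * r] is needed. *)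
Definition ore_mul (p q : {poly R}) : {poly R} :=
  \sum_(i < size p) p`_i *: iter i T q.

Lemma ore_mulE n (p q : {poly R}) :
  (size p <= n)%N -> ore_mul p q = \sum_(i < n) p`_i *: iter i T q.
Proof.
move=> pn; rewrite /ore_mul (big_ord_widen n (fun i => p`_i *: iter i T q) pn).
rewrite big_mkcond; apply: eq_bigr => i _; case: ltnP => // pi.
by rewrite nth_default // scale0r.
Qed.

Fact ore_mulDl : left_distributive ore_mul +%R.
Proof.
move=> p p' q; set n := maxn (size p) (size p').
rewrite !(@ore_mulE n) ?leq_maxl ?leq_maxr ?(leq_trans (size_polyD _ _)) //.
by rewrite -big_split; apply: eq_bigr => i _; rewrite coefD scalerDl.
Qed.

Lemma ore_mul_suml n (F : 'I_n -> {poly R}) q :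
  ore_mul (\sum_i F i) q = \sum_i ore_mul (F i) q.
Proof.
apply: (big_morph (ore_mul^~ q)) => [p p'|]; first exact: ore_mulDl.
by rewrite /ore_mul size_poly0 big_ord0.
Qed.

Lemma iter_shiftD i : {morph iter i T : p q / p + q}.
Proof. by elim: i => // i IH p q; rewrite !iterS IH raddfD. Qed.

Lemma ore_mulDr p : {morph ore_mul p : q q' / q + q'}.
Proof.
by move=> q q'; rewrite -big_split; apply: eq_bigr => i _;
  rewrite iter_shiftD scalerDr.
Qed.

Lemma ore_mulZ a p q : ore_mul (a *: p) q = a *: ore_mul p q.
Proof.
rewrite (@ore_mulE (size p)) ?size_scale_leq // scaler_sumr.
by apply: eq_bigr => i _; rewrite coefZ scalerA.
Qed.

Lemma ore_mulXn i q : ore_mul 'X^i q = iter i T q.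
Proof.
rewrite (@ore_mulE i.+1) ?size_polyXn // big_ord_recr /= big1 => [|j _].
  by rewrite coefXn eqxx scale1r add0r.
by rewrite coefXn ltn_eqF // scale0r.
Qed.

Lemma ore_mulC a q : ore_mul a%:P q = a *: q.
Proof. by rewrite -alg_polyC ore_mulZ -(expr0 'X) ore_mulXn. Qed.

(** This is associativity for triples that start with the variable, and the
    general case follows from it, because the product is linear in its left
    argument over the coefficients. *)
Lemma ore_mul_shift p q : ore_mul (T p) q = T (ore_mul p q).
Proof.
have sT : (size (T p) <= (size p).+1)%N.
  apply/leq_sizeP => [[|i]] // pi; rewrite coef_shift !nth_default ?rmorph0 //.
  - by rewrite linear0 addr0.
  - exact: ltnW.
rewrite (ore_mulE _ sT) (ore_mulE _ (leqnSn _)) raddf_sum /=.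
under eq_bigr do rewrite coef_shift scalerDl.
under [RHS]eq_bigr do rewrite (shiftZ (@sk_deltaM _ _ D)).
rewrite !big_split /=; congr (_ + _).
rewrite big_ord_recl [RHS]big_ord_recr /= scale0r add0r.
by rewrite nth_default // rmorph0 scale0r addr0.
Qed.

Lemma ore_mulA : associative ore_mul.
Proof.
move=> p q r; rewrite [ore_mul p q]/ore_mul ore_mul_suml.
apply: eq_bigr => i _; rewrite ore_mulZ; congr (_ *: _).
by move: {i}(i : nat); elim=> //= i IH; rewrite ore_mul_shift IH.
Qed.

Lemma ore_mul1l : left_id 1 ore_mul.
Proof. by move=> p; rewrite ore_mulC scale1r. Qed.

Lemma ore_mul1r : right_id 1 ore_mul.
Proof.
move=> p; rewrite /ore_mul -[RHS]coefK poly_def; apply: eq_bigr => i _.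
congr (_ *: _); move: {i}(i : nat); elim=> //= i ->.
by rewrite (shiftXn (@sk_deltaM _ _ D)).
Qed.

Fact ore_one_neq0 : (1 : {poly R}) != 0 :> ore_poly.
Proof. exact: oner_neq0. Qed.

HB.instance Definition _ := GRing.Zmodule_isNzRing.Build ore_poly
  ore_mulA ore_mul1l ore_mul1r ore_mulDl ore_mulDr ore_one_neq0.

Definition ore_scale (k : K) (p : ore_poly) : ore_poly := (k%:A : R) *: p.

Fact ore_scaleA a b u : ore_scale a (ore_scale b u) = ore_scale (a * b) u.
Proof. by rewrite /ore_scale scalerA mulr_algl scalerA. Qed.
Fact ore_scale1 : left_id 1 ore_scale.
Proof. by move=> p; rewrite /ore_scale !scale1r. Qed.
Fact ore_scaleDr : right_distributive ore_scale +%R.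
Proof. by move=> k p q; rewrite /ore_scale scalerDr. Qed.
Fact ore_scaleDl u : {morph ore_scale^~ u : a b / a + b}.
Proof. by move=> a b; rewrite /ore_scale !scalerDl. Qed.

HB.instance Definition _ := GRing.Zmodule_isLmodule.Build K ore_poly
  ore_scaleA ore_scale1 ore_scaleDr ore_scaleDl.

Fact ore_scaleAl k (u v : ore_poly) : k *: (u * v) = (k *: u : ore_poly) * v.
Proof. exact/esym/ore_mulZ. Qed.
HB.instance Definition _ :=
  GRing.Lmodule_isLalgebra.Build K ore_poly ore_scaleAl.

Fact ore_scaleAr k (u v : ore_poly) : k *: (u * v) = u * (k *: v : ore_poly).
Proof.
have Tk p : T (k%:A *: p) = k%:A *: T p.
  rewrite (shiftZ (@sk_deltaM _ _ D)) rmorph_alg linearZ /=.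
  by rewrite (skew_der1 (@sk_deltaM _ _ D)) scaler0 scale0r addr0.
have iTk i p : iter i T (k%:A *: p) = k%:A *: iter i T p.
  by elim: i => //= i ->.
rewrite -[LHS]/(k%:A *: ore_mul u v) -[RHS]/(ore_mul u (k%:A *: v)).
rewrite /ore_mul scaler_sumr.
by apply: eq_bigr => i _; rewrite iTk [LHS]scalerA [RHS]scalerA mulr_algl mulr_algr.
Qed.
HB.instance Definition _ :=
  GRing.Lalgebra_isAlgebra.Build K ore_poly ore_scaleAr.

Lemma ore_mulX q : ore_mul 'X q = T q.
Proof. exact: (ore_mulXn 1). Qed.

Lemma ore_expX i : ('X : ore_poly) ^+ i = 'X^i :> {poly R}.
Proof.
elim: i => [|i IH]; first by rewrite !expr0.
rewrite [LHS]exprS IH; apply: etrans (ore_mulX _) _.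
exact: (shiftXn (@sk_deltaM _ _ D)).
Qed.

End OrePoly.

Lemma ore_ext_exists (K : fieldType) (R : algType K)
    (sigma : {lrmorphism R -> R}) (delta : {linear R -> R}) :
  (forall r1 r2, delta (r1 * r2) = sigma r1 * delta r2 + delta r1 * r2) ->
  exists (S : algType K) (iota : {lrmorphism R -> S}) (x : S),
    is_ore_ext iota x sigma delta.
Proof.
move=> deltaM; pose D := SkewDerivation deltaM.
have [iota iotaE] : exists iota : {lrmorphism R -> ore_algebra D},
    iota =1 (fun r => r%:P : ore_algebra D).
  apply: lrmorphism_exists => [k u v||u v] //.
    apply: (etrans (polyCD _ _)); congr (_ + _).
    by rewrite /*:%R /= /ore_scale -mul_polyC -polyCM mulr_algl.
  by apply: (etrans (polyCM _ _)); rewrite mul_polyC -(ore_mulC D).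
have evE (p : {poly R}) :
    \sum_(i < size p) iota p`_i * ('X : ore_algebra D) ^+ i = p.
  rewrite -[RHS]coefK poly_def; apply: eq_bigr => i _.
  by rewrite iotaE ore_expX -[_ * _]/(ore_mul D _ _) ore_mulC.
exists (ore_algebra D), iota, 'X; split=> // [r|s].
  rewrite !iotaE -[LHS]/(ore_mul D 'X r%:P) ore_mulX.
  rewrite -[_ * _]/(ore_mul D _ _) ore_mulC /skew_shift !map_polyC /=.
  by rewrite mul_polyC.
by exists s; split=> [|p ->]; rewrite evE.
Qed.

(** * The universal property of an Ore extension *)
Section OreExtension.
Variables (K : fieldType) (R S : algType K) (iota : {lrmorphism R -> S}).
Variables (x : S) (sigma : {lrmorphism R -> R}) (delta : {linear R -> R}).
Hypothesis oreS : is_ore_ext iota x sigma delta.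

Local Notation E := (skew_eval iota x).

Lemma ore_extM r1 r2 : delta (r1 * r2) = sigma r1 * delta r2 + delta r1 * r2.
Proof. by case: oreS. Qed.

Lemma ore_ext_comm r : x * iota r = iota (sigma r) * x + iota (delta r).
Proof. by case: oreS. Qed.

Lemma ore_ext_poly s : exists p : {poly R}, E p = s.
Proof. by case: oreS => _ _ /(_ s) [p [-> _]]; exists p. Qed.

Definition ore_coef s : {poly R} := sval (cid (ore_ext_poly s)).

Lemma ore_coefK s : E (ore_coef s) = s.
Proof. by rewrite /ore_coef; case: cid. Qed.

Lemma skew_evalK p : ore_coef (E p) = p.
Proof.
case: oreS => _ _ /(_ (E p)) [q [_ q_uniq]].
rewrite -[RHS](q_uniq p (erefl _)) [LHS](esym (q_uniq _ _)) //.
by rewrite -/(E _) ore_coefK.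
Qed.

Lemma ore_coefB : zmod_morphism ore_coef.
Proof.
by move=> s t; rewrite -[s in LHS]ore_coefK -[t in LHS]ore_coefK -raddfB
  skew_evalK.
Qed.

HB.instance Definition _ := GRing.isZmodMorphism.Build S {poly R} ore_coef ore_coefB.

Lemma ore_coefMl r s : ore_coef (iota r * s) = r *: ore_coef s.
Proof. by rewrite -[s in LHS]ore_coefK -skew_evalZ skew_evalK. Qed.

Lemma ore_coefZ k s : ore_coef (k *: s) = k%:A *: ore_coef s.
Proof. by rewrite -ore_coefMl linearZ /= rmorph1 mulr_algl. Qed.

Lemma ore_coefXl s : ore_coef (x * s) = skew_shift sigma delta (ore_coef s).
Proof.
rewrite -[s in LHS]ore_coefK -(skew_eval_shift ore_ext_comm) skew_evalK //.
Qed.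

Lemma ore_coefXn i : ore_coef (x ^+ i) = 'X^i.
Proof. by rewrite -(skew_evalXn iota) skew_evalK. Qed.

(** [F] is the evaluation of coefficients at [y]. It is multiplicative because it
    respects left multiplication by [iota r] and by [x], and these generate
    [S]. *)
Lemma ore_lift (B : algType K) (f : {lrmorphism R -> B}) (y : B) :
  (forall r, y * f r = f (sigma r) * y + f (delta r)) ->
  exists F : {lrmorphism S -> B}, (forall r, F (iota r) = f r) /\ F x = y.
Proof.
move=> yf; pose F s := skew_eval f y (ore_coef s).
have Fiota r : F (iota r) = f r.
  by rewrite /F -[iota r](skew_evalC iota x) skew_evalK skew_evalC.
have FMl r s : F (iota r * s) = f r * F s by rewrite /F ore_coefMl skew_evalZ.
have FXl s : F (x * s) = y * F s.
  by rewrite /F ore_coefXl (skew_eval_shift yf).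
have FXn i s : F (x ^+ i * s) = y ^+ i * F s.
  elim: i => [|i IH]; first by rewrite !expr0 !mul1r.
  by rewrite !exprS -!mulrA FXl IH.
have F_D : {morph F : u v / u + v} by move=> u v; rewrite /F !raddfD.
have F0 : F 0 = 0 by rewrite /F !raddf0.
have [||u v|G GF] := @lrmorphism_exists K S B F.
- move=> k u v; rewrite F_D -[u in k *: u]mul1r scalerAl.
  by rewrite -(rmorph1 iota) -linearZ FMl linearZ /= rmorph1 mulr_algl.
- by rewrite -(rmorph1 iota) Fiota rmorph1.
- rewrite -[u in LHS]ore_coefK mulr_suml (big_morph F F_D F0) mulr_suml.
  by apply: eq_bigr => i _; rewrite -mulrA FMl FXn mulrA.
- exists G; split=> [r|]; rewrite GF //.
  by rewrite -[x]mulr1 FXl -(rmorph1 iota) Fiota rmorph1 mulr1.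
Qed.

End OreExtension.

(** Induction over the elements of a tower: the variables generate it as an
    algebra. *)
Lemma ore_tower_gen (K : fieldType) (A : algType K) (T : ore_tower A)
    (P : A -> Prop) :
  (forall k, P k%:A) ->
  (forall u v, P u -> P v -> P (u + v)) ->
  (forall u v, P u -> P v -> P (u * v)) ->
  (forall y, y \in ore_vars T -> P y) ->
  forall a, P a.
Proof.
elim: T P => [|R S T IH iota x sigma delta oreS] P PK PD PM PX a.
  by rewrite -[a]mulr1; apply: PK.
have Piota r : P (iota r).
  apply: (IH (fun r => P (iota r))) => {r} [k|u v|u v|y yT].
  - by rewrite rmorph_alg; apply: PK.
  - by rewrite rmorphD; apply: PD.
  - by rewrite rmorphM; apply: PM.
  - by apply: PX; rewrite /= mem_rcons inE map_f ?orbT.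
have Px i : P (x ^+ i).
  elim: i => [|i IHi]; first by rewrite expr0 -[1]scale1r.
  by rewrite exprS; apply: PM IHi; apply: PX; rewrite /= mem_rcons mem_head.
rewrite -[a](ore_coefK oreS); apply: (big_ind P) => // [|i _].
  by rewrite -[0](scale0r 1).
exact: PM.
Qed.

Lemma ore_tower_eq (K : fieldType) (A B : algType K) (T : ore_tower A)
    (f g : {lrmorphism A -> B}) :
  {in ore_vars T, f =1 g} -> f =1 g.
Proof.
move=> fg; apply: (ore_tower_gen (T := T)) => // [k|u v fu fv|u v fu fv].
- by rewrite !rmorph_alg.
- by rewrite !rmorphD /= fu fv.
- by rewrite !rmorphM /= fu fv.
Qed.

(** The condition that [ore_lift] asks for all [r] need only be checked on the
    variables, since it is stable under products by the twisted Leibniz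
    rule. *)
Lemma skew_comm_gen (K : fieldType) (R B : algType K) (T : ore_tower R)
    (sigma : {lrmorphism R -> R}) (delta : {linear R -> R})
    (f : {lrmorphism R -> B}) (y : B) :
  (forall r1 r2, delta (r1 * r2) = sigma r1 * delta r2 + delta r1 * r2) ->
  {in ore_vars T, forall v, y * f v = f (sigma v) * y + f (delta v)} ->
  forall r, y * f r = f (sigma r) * y + f (delta r).
Proof.
move=> deltaM yf; apply: (ore_tower_gen (T := T)) => // [k|u v yu yv|u v yu yv].
- have -> : delta k%:A = 0 by rewrite linearZ /= (skew_der1 deltaM) scaler0.
  by rewrite rmorph0 addr0 !rmorph_alg mulr_algl mulr_algr.
- by rewrite !raddfD /= mulrDl mulrDr yu yv addrACA.
rewrite deltaM !rmorphD !rmorphM /= mulrA yu mulrDl -mulrA yv mulrDr.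
by rewrite !mulrA addrA.
Qed.

(** * Linear spans and dimensions *)
Section LinearSpans.
Variables (K : fieldType) (V : lmodType K).

Definition submod (S : set V) :=
  S 0 /\ forall a u v, S u -> S v -> S (a *: u + v).

Lemma submod_closedP (S : set V) : GRing.submod_closed [in S] <-> submod S.
Proof.
split=> [[S0 SL]|[S0 SL]]; split=> [|a u v Su Sv].
- by move: S0; rewrite inE.
- by have := SL a u v; rewrite !inE; apply.
- by rewrite inE.
- by move: Su Sv; rewrite !inE; apply: SL.
Qed.

Lemma lin_span_submod (G : set V) : submod (lin_span G).
Proof.
split=> [S [/submod_closedP[]]//|a u v Gu Gv S [SS GS]].
have [_ SL] := (submod_closedP S).1 SS.
by apply: SL; [apply: Gu | apply: Gv].
Qed.

Lemma sub_lin_span (G : set V) : G `<=` lin_span G.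
Proof. by move=> u Gu S [_ GS]; apply: GS. Qed.

Lemma lin_span_min (G S : set V) : submod S -> G `<=` S -> lin_span G `<=` S.
Proof. by move=> SS GS u; apply; split=> //; apply/submod_closedP. Qed.

Lemma submodD (S : set V) u v : submod S -> S u -> S v -> S (u + v).
Proof. by case=> _ SL Su Sv; rewrite -[u]scale1r; apply: SL. Qed.

Lemma submodZ (S : set V) a u : submod S -> S u -> S (a *: u).
Proof. by case=> S0 SL Su; rewrite -[_ *: u]addr0; apply: SL. Qed.

Lemma submod_sum (S : set V) (I : Type) (r : seq I) (P : pred I) (F : I -> V) :
  submod S -> (forall i, P i -> S (F i)) -> S (\sum_(i <- r | P i) F i).
Proof.
move=> SS SF; apply: (big_ind S) => //; first by case: SS.
by move=> u v; apply: submodD.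
Qed.

Lemma lin_span_rangeP k (v : 'I_k -> V) u :
  lin_span (range v) u <-> exists a : 'I_k -> K, u = \sum_i a i *: v i.
Proof.
split=> [|[a ->]]; last first.
  apply: submod_sum => [|i _]; first exact: lin_span_submod.
  by apply: (submodZ _ (lin_span_submod _)); apply: sub_lin_span; exists i.
move: u; apply: (@lin_span_min _
  [set u | exists a : 'I_k -> K, u = \sum_i a i *: v i]) => [|u [i _ <-]].
  split=> [|a u w [b ->] [c ->]] /=.
    by exists (fun=> 0); rewrite big1 // => i _; rewrite scale0r.
  exists (fun i => a * b i + c i); rewrite scaler_sumr -big_split /=.
  by apply: eq_bigr => i _; rewrite scalerA -scalerDl.
exists (fun j => (j == i)%:R); rewrite (bigD1 i) //= eqxx scale1r big1 ?addr0 //.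
by move=> j /negPf->; rewrite scale0r.
Qed.

End LinearSpans.

Lemma has_dim0 (K : fieldType) (V : lmodType K) : has_dim [set 0 : V] 0.
Proof.
exists (fun=> 0); split=> [|a _ []//]; apply/seteqP; split=> u.
  by move=> /lin_span_rangeP[a ->]; rewrite big_ord0.
by move=> /= ->; case: (lin_span_submod (range (fun _ : 'I_0 => 0 : V))).
Qed.

(** Dimensions add up along an internal direct sum whose two summands are
    injective images of spaces that may live elsewhere. *)
Lemma has_dim_add (K : fieldType) (U1 U2 V : lmodType K)
    (f1 : {linear U1 -> V}) (f2 : {linear U2 -> V})
    (S1 : set U1) (S2 : set U2) (S : set V) (k1 k2 : nat) :
  has_dim S1 k1 -> has_dim S2 k2 ->
  (forall u1 u2, f1 u1 + f2 u2 = 0 -> u1 = 0 /\ u2 = 0) ->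
  (forall s, S s <-> exists u1 u2, [/\ S1 u1, S2 u2 & s = f1 u1 + f2 u2]) ->
  has_dim S (k1 + k2).
Proof.
move=> [v1 [<- free1]] [v2 [<- free2]] f_inj SE.
pose v i := match split i with inl j => f1 (v1 j) | inr j => f2 (v2 j) end.
have vl i : v (lshift k2 i) = f1 (v1 i).
  by rewrite /v (unsplitK (inl i : 'I_k1 + 'I_k2)).
have vr i : v (rshift k1 i) = f2 (v2 i).
  by rewrite /v (unsplitK (inr i : 'I_k1 + 'I_k2)).
have sumv (a : 'I_(k1 + k2) -> K) : \sum_i a i *: v i =
    f1 (\sum_i a (lshift k2 i) *: v1 i) + f2 (\sum_i a (rshift k1 i) *: v2 i).
  rewrite big_split_ord !linear_sum /=.
  by congr (_ + _); apply: eq_bigr => i _; rewrite ?vl ?vr linearZ.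
exists v; split=> [|a].
  apply/seteqP; split=> [s /lin_span_rangeP [a ->]|s /SE].
    apply/SE; rewrite sumv.
    by do 2!eexists; split; last reflexivity; apply/lin_span_rangeP; eexists.
  move=> [_ [_ [/lin_span_rangeP [a1 ->] /lin_span_rangeP [a2 ->] ->]]].
  apply/lin_span_rangeP.
  exists (fun i => match split i with inl j => a1 j | inr j => a2 j end).
  rewrite sumv; congr (f1 _ + f2 _); apply: eq_bigr => i _.
    by rewrite (unsplitK (inl i : 'I_k1 + 'I_k2)).
  by rewrite (unsplitK (inr i : 'I_k1 + 'I_k2)).
rewrite sumv => /f_inj [/free1 a1_0 /free2 a2_0] i.
by rewrite -(splitK i); case: (split i) => j /=; [exact: a1_0 | exact: a2_0].
Qed.

(** * Homogeneous components spanned by words *)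
Section WordComponents.
Variables (K : fieldType) (A : algType K) (g : seq (A * nat)).

Lemma hcomp_submod m : submod (hcomp g m).
Proof. exact: lin_span_submod. Qed.

Lemma hcomp_word (w : seq (A * nat)) :
  {subset w <= g} -> hcomp g (\sum_(y <- w) y.2)%N (\prod_(y <- w) y.1).
Proof. by move=> wg; apply: sub_lin_span; exists w. Qed.

(** Induction over homogeneous elements of all degrees at once, building words
    letter by letter from the left. *)
Lemma hcomp_min (S : nat -> set A) :
  (forall m, submod (S m)) -> S 0%N 1 ->
  (forall y m a, y \in g -> S m a -> S (y.2 + m)%N (y.1 * a)) ->
  forall m, hcomp g m `<=` S m.
Proof.
move=> SS S1 SM m; apply: lin_span_min => // _ [w [wg <-] <-].
elim: w wg => [|y w IHw] wg; first by rewrite !big_nil.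
rewrite !big_cons; apply: SM; first by rewrite wg ?mem_head.
by apply: IHw => z zw; rewrite wg // inE zw orbT.
Qed.

Lemma hcomp_1 : hcomp g 0 1.
Proof. by have := @hcomp_word [::]; rewrite !big_nil; apply. Qed.

Lemma hcomp_gen y : y \in g -> hcomp g y.2 y.1.
Proof.
have := @hcomp_word [:: y]; rewrite !big_seq1 => + yg; apply.
by move=> z /[!inE] /eqP ->.
Qed.

Lemma hcompM i j a b : hcomp g i a -> hcomp g j b -> hcomp g (i + j)%N (a * b).
Proof.
move=> + gb; move: i a.
apply: (hcomp_min (S := fun i => [set a | hcomp g (i + j) (a * b)])) => [m||] /=.
- have [S0 SL] := hcomp_submod (m + j); split=> /= [|a u v Su Sv].
    by rewrite mul0r.
  by rewrite mulrDl -scalerAl; apply: SL.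
- by rewrite mul1r.
move=> y m a yg Sa; rewrite -mulrA -addnA.
move: Sa; rewrite /hcomp; set G := [set _ | _ in _]; set G' := [set _ | _ in _].
apply: (lin_span_min (S := [set c | lin_span G' (y.1 * c)])) => [|_ [w [wg wm] <-]].
  have [S0 SL] := lin_span_submod G'; split=> /= [|k u v Su Sv].
    by rewrite mulr0.
  by rewrite mulrDr -scalerAr; apply: SL.
apply: sub_lin_span; exists (y :: w); rewrite ?big_cons //; split.
  by move=> z /[!inE] /predU1P [->|/wg].
by rewrite big_cons wm.
Qed.

Lemma hcompX m a i : hcomp g m a -> hcomp g (i * m)%N (a ^+ i).
Proof.
move=> ga; elim: i => [|i IH]; first by rewrite expr0; apply: hcomp_1.
by rewrite exprS mulSn; apply: hcompM.
Qed.

End WordComponents.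

Lemma hcomp_morph (K : fieldType) (A B : algType K) (g : seq (A * nat))
    (g' : seq (B * nat)) (F : {lrmorphism A -> B}) :
  (forall y, y \in g -> hcomp g' y.2 (F y.1)) ->
  forall m a, hcomp g m a -> hcomp g' m (F a).
Proof.
move=> gF; apply: (hcomp_min (S := fun m => [set a | hcomp g' m (F a)])) => /=.
- move=> m; have [S0 SL] := hcomp_submod g' m.
  by split=> /= [|a u v Su Sv]; rewrite ?rmorph0 ?linearP //; apply: SL.
- by rewrite rmorph1; apply: hcomp_1.
- by move=> y m a yg Sa; rewrite rmorphM; apply: hcompM Sa; apply: gF.
Qed.

(** The conditions on degrees pass from the generators to products. In the
    twisted Leibniz rule [delta] of a product also involves the second factor
    itself, so the degree of [a] is carried along in the induction. *)
Lemma hcomp_skew_der (K : fieldType) (A : algType K) (g : seq (A * nat))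
    (sigma : {lrmorphism A -> A}) (delta : {linear A -> A}) (e : nat) :
  (forall r1 r2, delta (r1 * r2) = sigma r1 * delta r2 + delta r1 * r2) ->
  (forall y, y \in g ->
     hcomp g y.2 (sigma y.1) /\ hcomp g (e + y.2)%N (delta y.1)) ->
  forall m a, hcomp g m a -> hcomp g (e + m)%N (delta a).
Proof.
move=> deltaM gsd m a ga.
suff [] : hcomp g m a /\ hcomp g (e + m)%N (delta a) by [].
move: m a ga; apply: (hcomp_min
  (S := fun m => [set a | hcomp g m a /\ hcomp g (e + m)%N (delta a)])) => /=.
- move=> m; have [S0 SL] := hcomp_submod g m.
  have [T0 TL] := hcomp_submod g (e + m).
  split=> /= [|a u v [Su Tu] [Sv Tv]]; first by rewrite linear0.
  by rewrite linearP; split; [apply: SL | apply: TL].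
- split; first exact: hcomp_1.
  by rewrite (skew_der1 deltaM); case: (hcomp_submod g (e + 0)).
move=> y m a yg [ga gda]; have [gs gd] := gsd y yg; split.
  by apply: hcompM ga; apply: hcomp_gen.
rewrite deltaM; apply: (submodD (hcomp_submod _ _)).
  by rewrite addnCA; apply: hcompM.
by rewrite addnA; apply: hcompM.
Qed.

(** * Homogeneous components of a graded Ore extension *)
Section GradedOreExtension.
Variables (K : fieldType) (R S : algType K) (iota : {lrmorphism R -> S}).
Variables (x : S) (sigma : {lrmorphism R -> R}) (delta : {linear R -> R}).
Hypothesis oreS : is_ore_ext iota x sigma delta.
Variables (g : seq (R * nat)) (e : nat).
Hypothesis e_gt0 : (0 < e)%N.
Hypothesis g_graded : forall y, y \in g ->
  hcomp g y.2 (sigma y.1) /\ hcomp g (e + y.2)%N (delta y.1).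

Local Notation E := (skew_eval iota x).
Local Notation c := (ore_coef oreS).
Local Notation gS := (rcons [seq (iota y.1, y.2) | y <- g] (x, e)).

(** In degree [m], the coefficient of [x ^+ i] must have degree [m - i * e]; no
    nonzero coefficient is possible once [i * e] exceeds [m]. *)
Definition ore_comp_coef m i : set R :=
  if (i * e <= m)%N then hcomp g (m - i * e) else [set 0].

Definition ore_comp m : set S :=
  [set s | forall i, ore_comp_coef m i (c s)`_i].

Lemma ore_comp_coef_submod m i : submod (ore_comp_coef m i).
Proof.
rewrite /ore_comp_coef; case: ifP => _; first exact: hcomp_submod.
by split=> // a u v /= -> ->; rewrite scaler0 addr0.
Qed.

Lemma ore_comp_coefS m i : ore_comp_coef (e + m) i.+1 = ore_comp_coef m i.
Proof. by rewrite /ore_comp_coef mulSn leq_add2l subnDl. Qed.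

Lemma sigma_comp_coef m i r :
  ore_comp_coef m i r -> ore_comp_coef m i (sigma r).
Proof.
rewrite /ore_comp_coef; case: ifP => _; last by move=> /= ->; rewrite rmorph0.
by apply: hcomp_morph => y /g_graded [].
Qed.

Lemma delta_comp_coef m i r :
  ore_comp_coef m i r -> ore_comp_coef (e + m) i (delta r).
Proof.
rewrite /ore_comp_coef; case: ifP => im.
  rewrite (leq_trans im (leq_addl _ _)) -addnBA //.
  exact: (hcomp_skew_der (ore_extM oreS)).
by move=> /= ->; rewrite linear0; case: ifP => // _; case: (hcomp_submod g (e + m - i * e)).
Qed.

Lemma ore_comp_coefM m k r i s : hcomp g k r -> ore_comp_coef m i s ->
  ore_comp_coef (k + m) i (r * s).
Proof.
rewrite /ore_comp_coef => gr; case: ifP => im.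
  rewrite (leq_trans im (leq_addl _ _)) -addnBA //.
  exact: hcompM.
by move=> /= ->; rewrite mulr0; case: ifP => // _; case: (hcomp_submod g (k + m - i * e)).
Qed.

Lemma ore_comp_submod m : submod (ore_comp m).
Proof.
split=> [i|a u v Vu Vv i] /=.
  by rewrite raddf0 coef0; case: (ore_comp_coef_submod m i).
rewrite raddfD /= ore_coefZ coefD coefZ mulr_algl.
by case: (ore_comp_coef_submod m i) => _; apply.
Qed.

(** Straightening. Words in the variables, in any order, span the elements whose
    normal form [\sum_i iota r_i * x ^+ i] is homogeneous term by term, because
    moving [x] to the right across a homogeneous coefficient preserves the total
    degree. *)
Lemma hcomp_ore m : hcomp gS m = ore_comp m.
Proof.
apply/seteqP; split.
  apply: hcomp_min => [{}m|i|y {}m a].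
  - exact: ore_comp_submod.
  - have := ore_coefXn oreS 0; rewrite !expr0 => ->; rewrite coef1.
    rewrite /ore_comp_coef leqn0 muln_eq0 -[e == 0%N]negbK -lt0n e_gt0 orbF.
    by case: eqP => [->|//]; rewrite subn0; apply: hcomp_1.
  rewrite mem_rcons inE => /predU1P [-> /=|/mapP [z zg ->]] Va i /=.
    rewrite ore_coefXl coef_shift; apply: (submodD (ore_comp_coef_submod _ _)).
      case: i => [|i]; first by case: (ore_comp_coef_submod (e + m) 0).
      by rewrite ore_comp_coefS; apply: sigma_comp_coef.
    exact: delta_comp_coef.
  by rewrite ore_coefMl coefZ; apply: ore_comp_coefM (hcomp_gen zg) (Va i).
move=> s Vs; rewrite -(ore_coefK oreS s).
rewrite /skew_eval; apply: submod_sum => [|i _]; first exact: hcomp_submod.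
have := Vs i; rewrite /ore_comp_coef; case: leqP => [im gc|_ ->]; last first.
  by rewrite rmorph0 mul0r; case: (hcomp_submod gS m).
rewrite -(subnK im); apply: hcompM.
  move: gc; apply: hcomp_morph => y yg.
  have := @hcomp_gen _ _ gS (iota y.1, y.2); apply.
  by rewrite mem_rcons inE (map_f (fun y => (iota y.1, y.2))) ?orbT.
have := @hcomp_gen _ _ gS (x, e).
by rewrite mem_rcons mem_head => /(_ isT); apply: hcompX.
Qed.

Lemma skew_evalMX p : E (p * 'X) = E p * x.
Proof.
rewrite (@skew_evalE _ _ _ _ _ (size p).+1); last first.
  by rewrite (leq_trans (size_polyMleq _ _)) // size_polyX addn2.
rewrite big_ord_recl coefMX /= rmorph0 mul0r add0r mulr_suml.
by apply: eq_bigr => i _; rewrite coefMX /= exprSr mulrA.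
Qed.

Lemma ore_coefXr s : c (s * x) = c s * 'X.
Proof. by rewrite -[s in LHS](ore_coefK oreS) -skew_evalMX skew_evalK. Qed.

Lemma ore_coefC r : c (iota r) = r%:P.
Proof. by rewrite -(skew_evalC iota x) skew_evalK. Qed.

Lemma coef_ore_split0 r t : (c (iota r + t * x))`_0 = r.
Proof.
by rewrite raddfD /= ore_coefC ore_coefXr coefD coefC coefMX addr0.
Qed.

Lemma coef_ore_splitS r t i : (c (iota r + t * x))`_i.+1 = (c t)`_i.
Proof.
by rewrite raddfD /= ore_coefC ore_coefXr coefD coefC coefMX add0r.
Qed.

(** Splitting off the constant coefficient gives
    [S_m = iota R_m (+) S_(m - e) * x], the recurrence behind the Hilbert
    series. *)
Lemma ore_comp_split m s : ore_comp m s <->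
  exists r t, [/\ hcomp g m r,
    (if (e <= m)%N then ore_comp (m - e) else [set 0]) t & s = iota r + t * x].
Proof.
split=> [Vs|[r [t [gr Vt ->]]] i].
  pose t := E (drop_poly 1 (c s)).
  have sE : s = iota (c s)`_0 + t * x.
    rewrite -skew_evalMX -(skew_evalC iota x) -raddfD -[LHS](ore_coefK oreS) /=.
    congr E; apply/polyP => i; rewrite coefD coefC coefMX.
    by case: i => [|i]; rewrite ?addr0 ?add0r ?coef_drop_poly ?addn1.
  exists (c s)`_0, t; split=> //.
    by have := Vs 0%N; rewrite /ore_comp_coef mul0n subn0.
  have tE i : (c t)`_i = (c s)`_i.+1 by rewrite sE coef_ore_splitS.
  case: ifP => em.
    move=> i; rewrite tE; have := Vs i.+1.
    by rewrite -{1}(subnKC em) ore_comp_coefS.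
  rewrite /= -(ore_coefK oreS t); suff -> : c t = 0 by rewrite raddf0.
  apply/polyP=> i; rewrite tE coef0; have := Vs i.+1.
  rewrite /ore_comp_coef mulSn ifF //; apply/negP => im.
  by rewrite (leq_trans (leq_addr _ _) im) in em.
case: i => [|i]; first by rewrite coef_ore_split0 /ore_comp_coef mul0n subn0.
rewrite coef_ore_splitS; move: Vt; case: ifP => [em Vt|_ ->].
  by rewrite -(subnKC em) ore_comp_coefS.
by rewrite raddf0 coef0; case: (ore_comp_coef_submod m i.+1).
Qed.

Lemma ore_comp_dim (h h' : nat -> nat) :
  (forall m, has_dim (hcomp g m) (h m)) ->
  (forall m, h' m = h m + if e <= m then h' (m - e) else 0)%N ->
  forall m, has_dim (ore_comp m) (h' m).
Proof.
move=> dim_h h'E.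
have [f2 f2E] : exists f : {linear S -> S}, f =1 ( *%R^~ x).
  by apply: linear_exists => k u v; rewrite mulrDl scalerAl.
elim/ltn_ind => m IH; rewrite h'E.
apply: (has_dim_add (f1 := iota) (f2 := f2)
  (S2 := if (e <= m)%N then ore_comp (m - e) else [set 0])) (dim_h m) _ _ _.
- case: ifP => em; last exact: has_dim0.
  by apply: IH; rewrite ltn_subrL e_gt0 (leq_trans e_gt0).
- move=> r t; rewrite f2E => rt0; split.
    by rewrite -(coef_ore_split0 r t) rt0 raddf0 coef0.
  rewrite -(ore_coefK oreS t); suff -> : c t = 0 by rewrite raddf0.
  by apply/polyP => i; rewrite -(coef_ore_splitS r) rt0 raddf0 !coef0.
- move=> s; rewrite ore_comp_split.
  by split=> [] [r [t [gr Vt ->]]]; exists r, t; rewrite f2E.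
Qed.

End GradedOreExtension.

(** * Grading and Hilbert series of a graded tower *)
Lemma sum_coef_horner (A : nzRingType) (p : {poly A}) :
  \sum_(m < size p) p`_m = p.[1].
Proof.
by rewrite horner_coef; apply: eq_bigr => m _; rewrite expr1n mulr1.
Qed.

Lemma sum_shift (V : nmodType) (a : nat -> V) (n k : nat) :
  (forall m, (m < k)%N -> a m = 0) -> (forall m, (n <= m)%N -> a m = 0) ->
  \sum_(j < n) a (j + k)%N = \sum_(m < n) a m.
Proof.
move=> a_small a_big; transitivity (\sum_(0 <= m < n + k) a m).
  rewrite (@big_cat_nat _ _ _ k) ?leq_addl //=.
  have -> : \sum_(0 <= m < k) a m = 0.
    by rewrite big_nat big1 // => m /andP[_ mk]; apply: a_small.
  rewrite add0r -[in RHS](add0n k) big_addn add0n addnK.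
  by rewrite (big_mkord xpredT (fun j => a (j + k)%N)).
rewrite (@big_cat_nat _ _ _ n) ?leq_addr //= big_mkord.
have -> : \sum_(n <= m < n + k) a m = 0.
  by rewrite big_nat big1 // => m /andP[nm _]; apply: a_big.
by rewrite addr0.
Qed.

(** A finite family with one element in each degree is the coefficient sequence
    of a polynomial, and its sum is the value at [1]. The condition says that
    the sum of the subspaces [A_ m] is direct. *)
Definition independent_comps (A : nzRingType) (A_ : nat -> set A) :=
  forall p : {poly A}, (forall m, A_ m p`_m) -> p.[1] = 0 -> p = 0.

(** Directness for [S] follows from directness for [R] in each power of [x]
    separately: the coefficients of [x ^+ i] of the members of a family are
    homogeneous, of degrees shifted by [i * e]. *)
Lemma ore_comp_independent (K : fieldType) (R S : algType K)
    (iota : {lrmorphism R -> S}) (x : S) (sigma : {lrmorphism R -> R})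
    (delta : {linear R -> R}) (oreS : is_ore_ext iota x sigma delta)
    (g : seq (R * nat)) (e : nat) :
  independent_comps (hcomp g) -> independent_comps (ore_comp oreS g e).
Proof.
move=> g_ind q Vq q1; pose a i m := (ore_coef oreS q`_m)`_i.
have a_small i m : (m < i * e)%N -> a i m = 0.
  by move=> mi; have := Vq m i; rewrite /ore_comp_coef leqNgt mi.
have a_big i m : (size q <= m)%N -> a i m = 0.
  by move=> qm; rewrite /a (nth_default _ qm) raddf0 coef0.
suff a0 i m : a i m = 0.
  apply/polyP => m; rewrite coef0 -(ore_coefK oreS q`_m).
  suff -> : ore_coef oreS q`_m = 0 by rewrite raddf0.
  by apply/polyP => i; rewrite coef0; apply: a0.
pose p := \poly_(k < size q) a i (k + i * e)%N.
suff p0 : p = 0.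
  have [/a_small // | im] := ltnP m (i * e).
  have [|/a_big //] := ltnP m (size q) => mq.
  have := congr1 (fun r : {poly R} => r`_(m - i * e)) p0.
  by rewrite coef0 coef_poly subnK // (leq_ltn_trans (leq_subr _ _) mq).
apply: g_ind => [k|].
  rewrite coef_poly; case: ifP => _; last by case: (hcomp_submod g k).
  by have := Vq (k + i * e)%N i; rewrite /ore_comp_coef leq_addl addnK.
rewrite horner_poly.
under eq_bigr do rewrite expr1n mulr1.
rewrite sum_shift; [|exact: a_small|exact: a_big].
transitivity (ore_coef oreS q.[1])`_i; last by rewrite q1 raddf0 coef0.
by rewrite -sum_coef_horner raddf_sum coef_sum.
Qed.

Lemma recurrence_exists (h : nat -> nat) (e : nat) : (0 < e)%N ->
  exists h' : nat -> nat,
    forall m, h' m = (h m + if e <= m then h' (m - e) else 0)%N.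
Proof.
move=> e_gt0.
(* [F n] computes the values below [n]: recursion on the fuel [n] replaces the
   recursion on [m], which is not structural. *)
pose F := fix F n m : nat := if n is n'.+1 then
  (h m + if e <= m then F n' (m - e) else 0)%N else 0%N.
have F_stable n1 n2 m : (m < n1)%N -> (m < n2)%N -> F n1 m = F n2 m.
  elim: n1 n2 m => // n1 IH [|n2] // m m1 m2 /=; case: ifP => // em.
  have mem : (m - e < m)%N by rewrite ltn_subrL e_gt0 (leq_trans e_gt0 em).
  by congr (_ + _)%N; apply: IH; rewrite (leq_trans mem).
exists (fun m => F m.+1 m) => m /=; case: ifP => // em.
congr (_ + _)%N; apply: (F_stable m (m - e).+1) => //.
by rewrite ltn_subrL e_gt0 (leq_trans e_gt0 em).
Qed.

(** The recurrence says that [h] is [h'] multiplied by [1 - t^e], so adjoining a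
    variable of degree [e] multiplies the inverse of the series by
    [1 - t^e]. *)
Lemma fps_eq_inv_geometric (h h' : nat -> nat) (e : nat) (p : {poly int}) :
  (forall m, h' m = h m + if e <= m then h' (m - e) else 0)%N ->
  fps_eq_inv h p -> fps_eq_inv h' (p * (1 - 'X^e)).
Proof.
move=> h'E hp m; rewrite -(hp m).
pose U := \poly_(i < m.+1) (h' i)%:Z.
transitivity ((p * (1 - 'X^e) * U)`_m).
  rewrite coefM; apply: eq_bigr => i _; rewrite coef_poly.
  by rewrite ltnS leq_subr.
rewrite -mulrA coefM; apply: eq_bigr => i _; congr (_ * _).
rewrite mulrBl mul1r coefB coefXnM !coef_poly ltnS leq_subr h'E.
case: ltnP => [ie|ei]; first by rewrite subr0 addn0.
by rewrite ltnS (leq_trans (leq_subr _ _)) ?leq_subr // PoszD addrK.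
Qed.

Lemma zip_rcons_map (S T : Type) (f : S -> T) (s : seq S) (x : T) (d : seq nat) :
  (size s < size d)%N ->
  zip (rcons (map f s) x) d =
    rcons [seq (f y.1, y.2) | y <- zip s d] (x, nth 0%N d (size s)).
Proof.
by elim: s d => [|z s IH] [|e d] //= sd; [case: d {sd} | rewrite IH].
Qed.

Lemma hcomp_nil (K : fieldType) (A : algType K) m :
  hcomp [::] m = if m == 0%N then lin_span [set 1 : A] else [set 0].
Proof.
apply/seteqP; split.
  apply: (hcomp_min (S := fun m =>
    if m == 0%N then lin_span [set 1 : A] else [set 0])) => //= [{}m|].
    case: ifP => _; first exact: lin_span_submod.
    by split=> // a u v /= -> ->; rewrite scaler0 addr0.
  exact: sub_lin_span.
case: eqP => [->|_ _ -> /=]; last by case: (hcomp_submod ([::] : seq (A * nat)) m).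
by apply: lin_span_min => [|_ ->]; [exact: hcomp_submod | exact: hcomp_1].
Qed.

(** Both claims go up the tower one variable at a time. With directness the
    components form a grading, and the dimensions are those of a commutative
    polynomial ring in variables of the same degrees. *)
Theorem ore_tower_hilbert (K : fieldType) (A : algType K) (T : ore_tower A)
    (d : seq nat) :
  (size (ore_vars T) <= size d)%N -> ore_graded d T ->
  independent_comps (hcomp (zip (ore_vars T) d)) /\
  exists2 h : nat -> nat, forall m, has_dim (hcomp (zip (ore_vars T) d) m) (h m) &
    fps_eq_inv h (\prod_(e <- take (size (ore_vars T)) d) (1 - 'X^e)).
Proof.
elim: T => [|R S T IH iota x sigma delta oreS] /=.
  move=> _ _; have -> : zip ([::] : seq K^o) d = [::] by case: d.
  split=> [p gp p1|]; last first.
    exists (fun m => (m == 0%N) : nat) => [m|m].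
      rewrite hcomp_nil; case: (m == 0%N); last exact: has_dim0.
      exists (fun=> 1); split=> [|a].
        by congr lin_span; apply/seteqP; split=> [_ [_ _ <-]|_ ->] //; exists ord0.
      by rewrite big_ord1 => /eqP; rewrite scaler_eq0 oner_eq0 orbF
        => /eqP a0 i; rewrite ord1.
    rewrite take0 big_nil big_ord_recl coef1 mul1r subn0 big1 ?addr0.
      by case: m.
    by move=> i _; rewrite coef1 mul0r.
  have p0 m : (0 < m)%N -> p`_m = 0.
    by move=> m0; have := gp m; rewrite hcomp_nil eqn0Ngt m0.
  apply/polyP => -[|m]; last by rewrite p0 ?coef0.
  have sp : (size p <= 1)%N by apply/leq_sizeP => m; apply: p0.
  by move: p1; rewrite {1}(size1_polyC sp) hornerC coef0.
rewrite size_rcons size_map => sd [/(IH (ltnW sd)) [g_ind [h dim_h hP]]] e0 gsd.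
rewrite zip_rcons_map //; set g := zip _ d in g_ind dim_h gsd *.
set e := nth _ _ _ in e0 gsd *.
have hE : hcomp (rcons [seq (iota y.1, y.2) | y <- g] (x, e)) =
    ore_comp oreS g e by apply/funext => m; apply: hcomp_ore.
rewrite hE; split; first exact: ore_comp_independent.
have [h' h'E] := recurrence_exists h e0.
exists h' => [m|]; first exact: (ore_comp_dim oreS e0 dim_h h'E).
by rewrite (take_nth 0%N) // big_rcons /=; apply: fps_eq_inv_geometric h'E hP.
Qed.

Lemma ore_tower_grading (K : fieldType) (A : algType K) (T : ore_tower A)
    (d : seq nat) :
  size d = size (ore_vars T) -> ore_graded d T ->
  is_grading (hcomp (zip (ore_vars T) d)).
Proof.
move=> sd dT; have [g_ind _] := ore_tower_hilbert (eq_leq (esym sd)) dT.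
set g := zip _ _ in g_ind *; split=> [m|||a].
- by apply/submod_closedP; apply: hcomp_submod.
- exact: hcomp_1.
- by move=> i j a b; apply: hcompM.
(* Sums and products of decomposed elements correspond to sums and products of
   polynomials, and evaluation at [1] is a morphism. *)
have [p gp ap] : exists2 p : {poly A}, forall m, hcomp g m p`_m & a = p.[1].
  have g0 m : hcomp g m 0 by case: (hcomp_submod g m).
  pose Q a := exists2 p : {poly A}, forall m, hcomp g m p`_m & a = p.[1].
  apply: (ore_tower_gen (T := T) (P := Q)) => [k|u v [p gp ->] [q gq ->]|u v [p gp ->] [q gq ->]|y yT].
  - exists k%:A%:P; rewrite ?hornerC // => m; rewrite coefC; case: ifP => // /eqP->.
    by apply: (submodZ k (hcomp_submod g 0)); apply: hcomp_1.
  - exists (p + q); rewrite ?hornerD // => m; rewrite coefD.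
    by apply: (submodD (hcomp_submod g m)).
  - exists (p * q) => [m|].
      rewrite coefM; apply: submod_sum => [|i _]; first exact: hcomp_submod.
      by rewrite -[m in hcomp _ m](subnKC (leq_ord i)); apply: hcompM.
    by rewrite hornerM_comm // /comm_poly mulr1 mul1r.
  - have [e ye] : exists e, (y, e) \in g.
      move: yT; rewrite /g; elim: (ore_vars T) d sd {dT g g_ind g0 Q} => // z s IH.
      case=> // e d' [sd]; rewrite inE => /predU1P [->|/(IH _ sd) [e' ye']].
        by exists e; rewrite mem_head.
      by exists e'; rewrite inE ye' orbT.
    exists (y *: 'X^e); last by rewrite hornerZ hornerXn expr1n mulr1.
    move=> m; rewrite coefZ coefXn; case: eqP => [->|]; last by rewrite mulr0.
    by rewrite mulr1; apply: (hcomp_gen ye).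
exists p; split=> [|q [gq aq]]; first by rewrite sum_coef_horner.
apply/eqP; rewrite -subr_eq0; apply/eqP; apply: g_ind => [m|].
  rewrite coefB -scaleN1r; apply: (submodD (hcomp_submod _ _)) => //.
  by apply: (submodZ _ (hcomp_submod g m)).
by rewrite hornerD hornerN -ap aq sum_coef_horner subrr.
Qed.

(** * Free algebras and their quotients *)
Section FreeAlgebra.
Variables (K : fieldType) (n : nat).
Local Notation F := (free_alg K n).
Local Notation word := {fmonom 'I_n}.

Lemma free_monomE (m : word) :
  << m >> = \prod_(i <- (m : seq 'I_n)) free_gen K i :> F.
Proof.
case: m => s /=; elim: s => [|i s IH]; rewrite ?big_nil ?big_cons.
  by congr (<< _ >>); apply/val_inj/esym/fm1.
rewrite -IH /free_gen malgM_def fgmulUU mulr1; congr (<< _ >>).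
by apply/val_inj; rewrite /= fmM fmU.
Qed.

Lemma free_alg_gen (P : F -> Prop) :
  (forall k, P k%:A) ->
  (forall u v, P u -> P v -> P (u + v)) ->
  (forall u v, P u -> P v -> P (u * v)) ->
  (forall i, P (free_gen K i)) ->
  forall f, P f.
Proof.
move=> PK PD PM PX f; rewrite [f]monalgE; apply: (big_ind P) => //.
  by rewrite -[0](scale0r 1).
move=> m _; have -> : << f@_m *g m >> = (f@_m)%:A * << m >> :> F.
  by rewrite mulr_algl; apply/malgP => m'; rewrite mcoeffZ !mcoeffU mulr_natr.
rewrite free_monomE; apply: (PM _ _ (PK _)); apply: (big_ind P) => //.
by rewrite -[1]scale1r.
Qed.

Lemma free_lift (B : algType K) (y : 'I_n -> B) :
  exists f : {lrmorphism F -> B}, forall i, f (free_gen K i) = y i.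
Proof.
pose h (m : word) := \prod_(i <- (m : seq 'I_n)) y i.
have hM : mmorphism h.
  split=> [u v|]; first by rewrite /h fmM big_cat.
  by rewrite /h fm1 big_nil.
pose hm := isMultiplicative.Build _ _ h hM.
pose H : {mmorphism word -> B} := HB.pack h hm.
pose c : {rmorphism K -> B} := in_alg B.
pose f : F -> B := mmap c H.
have fC (g : F) m m' : GRing.comm (c g@_m) (H m').
  by rewrite /GRing.comm /= mulr_algl mulr_algr.
have [fM f1] := commr_mmap_is_multiplicative fC.
have [|||f' f'E] := @lrmorphism_exists K F B f.
- move=> k u v; rewrite /f raddfD; congr (_ + _).
  by apply: (etrans (mmapZ _ _)); rewrite /c /= mulr_algl.
- exact: f1.
- exact: fM.
exists f' => i; rewrite f'E /f mmapU /c /= scale1r mul1r.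
by rewrite /h fmU big_seq1.
Qed.

Lemma free_eq (B : algType K) (f g : {lrmorphism F -> B}) :
  (forall i, f (free_gen K i) = g (free_gen K i)) -> f =1 g.
Proof.
move=> fg; apply: free_alg_gen => [k|u v fu fv|u v fu fv|//].
- by rewrite !rmorph_alg.
- by rewrite !rmorphD /= fu fv.
- by rewrite !rmorphM /= fu fv.
Qed.

Lemma mcoeff_free_monom (s : seq 'I_n) (m : word) :
  (\prod_(i <- s) free_gen K i : F)@_m = (s == m :> seq 'I_n)%:R.
Proof. by rewrite -(free_monomE (FMonom s)) mcoeffU1. Qed.

(** If [a * f * b] has a monomial that is a factor of [w], then [f] has a
    monomial that is a factor of it, hence of [w]. Such ideals detect when a
    generator does not follow from others: it suffices that its coefficient at
    [w] is nonzero. *)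
Lemma infix_free_ideal (w : seq 'I_n) :
  ideal_closed [set f : F | forall m : word, infix m w -> f@_m = 0].
Proof.
split=> /= [m _|f g f0 g0 m mw|a f b f0 m mw]; first by rewrite mcoeff0.
  by rewrite mcoeffB f0 ?g0 ?subrr.
have af0 : forall m' : word, infix m' w -> (a * f)@_m' = 0.
  move=> m' m'w; rewrite mcoeffMl big1 // => m1 _; rewrite big1 // => m2 _.
  case: eqP => [m'E|_]; last by rewrite mulr0n.
  rewrite f0 ?mulr0 ?mul0rn //; apply: infix_trans m'w.
  by rewrite -m'E fmM; apply: suffixW; apply: suffix_suffix.
rewrite mcoeffMl big1 // => m1 _; rewrite big1 // => m2 _.
case: eqP => [mE|_]; last by rewrite mulr0n.
rewrite af0 ?mul0r ?mul0rn //; apply: infix_trans mw.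
by rewrite -mE fmM; apply: prefixW; apply: prefix_prefix.
Qed.

End FreeAlgebra.

Lemma ideal_gen_sub (F : nzRingType) (G S : set F) :
  ideal_closed S -> G `<=` S -> ideal_gen G `<=` S.
Proof. by move=> SI GS f; apply; split. Qed.

Lemma sub_ideal_gen (F : nzRingType) (G : set F) : G `<=` ideal_gen G.
Proof. by move=> f Gf S [_ GS]; apply: GS. Qed.

Lemma ideal_closed_ker (K : fieldType) (F B : algType K)
    (f : {lrmorphism F -> B}) : ideal_closed [set u | f u = 0].
Proof.
split=> /= [|u v fu fv|a u b fu]; first by rewrite rmorph0.
  by rewrite rmorphB /= fu fv subrr.
by rewrite !rmorphM /= fu mulr0 mul0r.
Qed.

Lemma quot_lift (K : fieldType) (F B : algType K) (I : Defs.proper_ideal F)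
    (f : {lrmorphism F -> B}) :
  ideal_set I `<=` [set u | f u = 0] ->
  exists g : {lrmorphism quot_alg I -> B}, forall u, g (quot_pi I u) = f u.
Proof.
move=> If; have fE u v : quot_pi I u = quot_pi I v -> f u = f v.
  by move=> /quot_piP/If /= fuv; apply: subr0_eq; rewrite -fuv rmorphB.
pose g (u : quot_alg I) := f (repr u).
have gE u : g (quot_pi I u) = f u by apply: fE; rewrite quot_piK.
have [|||g' g'E] := @lrmorphism_exists K (quot_alg I) B g.
- move=> k u v; rewrite -[u]quot_piK -[v]quot_piK -linearZ -rmorphD !gE.
  by rewrite linearP.
- by rewrite -(rmorph1 (quot_pi I)) gE rmorph1.
- by move=> u v; rewrite -[u]quot_piK -[v]quot_piK -rmorphM !gE rmorphM.
by exists g' => u; rewrite g'E gE.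
Qed.

Lemma quot_eq (K : fieldType) (n : nat) (B : algType K)
    (I : Defs.proper_ideal (free_alg K n)) (f g : {lrmorphism quot_alg I -> B}) :
  (forall i, f (quot_pi I (free_gen K i)) = g (quot_pi I (free_gen K i))) ->
  f =1 g.
Proof.
move=> fg u; rewrite -[u]quot_piK.
exact: (free_eq (f := f \o quot_pi I) (g := g \o quot_pi I) fg).
Qed.

(** * Reduction of noncommutative polynomials over the Eisenstein integers *)

(** The pair [(p, q)] stands for [p + q * b] with [b ^+ 2 = - b - 1]. *)
Definition eisenstein : Type := (int * int)%type.

Definition eis_add (u v : eisenstein) : eisenstein := (u.1 + v.1, u.2 + v.2).

Definition eis_mul (u v : eisenstein) : eisenstein :=
  (u.1 * v.1 - u.2 * v.2, u.1 * v.2 + u.2 * v.1 - u.2 * v.2).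

(** Formal sums of scaled words in letters indexed by natural numbers. Like terms
    need not be collected. *)
Definition nc_poly : Type := seq (eisenstein * seq nat).

Definition nc_scale (c : eisenstein) (p : nc_poly) : nc_poly :=
  [seq (eis_mul c t.1, t.2) | t <- p].

Definition nc_wmul (u : seq nat) (p : nc_poly) (v : seq nat) : nc_poly :=
  [seq (t.1, u ++ t.2 ++ v) | t <- p].

Definition rewrite_rules : Type := seq (seq nat * nc_poly).

Fixpoint rewrite_head (rs : rewrite_rules) (w : seq nat) : option nc_poly :=
  if rs is (l, p) :: rs' then
    if prefix l w then Some (nc_wmul [::] p (drop (size l) w))
    else rewrite_head rs' w
  else None.

(** Rewrites at the leftmost position where some rule applies. *)
Fixpoint rewrite_word (rs : rewrite_rules) (w : seq nat) : option nc_poly :=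
  if rewrite_head rs w is Some p then Some p
  else if w is i :: w' then
    if rewrite_word rs w' is Some p then Some (nc_wmul [:: i] p [::]) else None
  else None.

Fixpoint normal_form (rs : rewrite_rules) (fuel : nat)
    (t : eisenstein * seq nat) : nc_poly :=
  if fuel is n.+1 then
    if rewrite_word rs t.2 is Some p then
      flatten [seq normal_form rs n u | u <- nc_scale t.1 p]
    else [:: t]
  else [:: t].

Fixpoint nc_insert (t : eisenstein * seq nat) (p : nc_poly) : nc_poly :=
  if p is u :: p' then
    if t.2 == u.2 then (eis_add t.1 u.1, u.2) :: p' else u :: nc_insert t p'
  else [:: t].

Definition nc_collect (p : nc_poly) : nc_poly := foldr nc_insert [::] p.

(** The fuel only bounds the length of a chain of rewriting steps. When it runs
    out, the result is still a correct expression of [p], possibly not a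
    reduced one. *)
Definition nc_normal (rs : rewrite_rules) (p : nc_poly) : nc_poly :=
  nc_collect (flatten [seq normal_form rs 50 t | t <- p]).

Definition nc_zero (p : nc_poly) : bool :=
  all (fun t => (t.1.1 == 0) && (t.1.2 == 0)) p.

Definition nc_eq (rs : rewrite_rules) (p q : nc_poly) : bool :=
  nc_zero (nc_normal rs (p ++ nc_scale (-1, 0) q)).

Definition nc_letters (n : nat) (p : nc_poly) : bool :=
  all (fun t => all (fun i => i < n)%N t.2) p.

Section Evaluation.
Variables (K : fieldType) (b : K).

Definition eis_eval (z : eisenstein) : K := z.1%:~R + z.2%:~R * b.

Lemma eis_evalD u v : eis_eval (eis_add u v) = eis_eval u + eis_eval v.
Proof. by rewrite /eis_eval /= !rmorphD mulrDl addrACA. Qed.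

Lemma eis_eval_int m : eis_eval (m, 0) = m%:~R.
Proof. by rewrite /eis_eval mul0r addr0. Qed.

Section Words.
Variables (A : algType K) (y : nat -> A).

Definition word_eval (w : seq nat) : A := \prod_(i <- w) y i.

Definition nc_eval (p : nc_poly) : A :=
  \sum_(t <- p) eis_eval t.1 *: word_eval t.2.

Lemma word_eval_nil : word_eval [::] = 1.
Proof. exact: big_nil. Qed.

Lemma word_eval_cons i w : word_eval (i :: w) = y i * word_eval w.
Proof. exact: big_cons. Qed.

Lemma nc_eval_nil : nc_eval [::] = 0.
Proof. exact: big_nil. Qed.

Lemma nc_eval_cons t p :
  nc_eval (t :: p) = eis_eval t.1 *: word_eval t.2 + nc_eval p.
Proof. exact: big_cons. Qed.

Lemma nc_eval_pair j i : nc_eval [:: ((1, 0), [:: j; i])] = y j * y i.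
Proof.
rewrite nc_eval_cons nc_eval_nil addr0 eis_eval_int scale1r.
by rewrite !word_eval_cons word_eval_nil mulr1.
Qed.

Lemma nc_eval_cat p q : nc_eval (p ++ q) = nc_eval p + nc_eval q.
Proof. exact: big_cat. Qed.

Lemma nc_eval_flatten (T : Type) (F : T -> nc_poly) (s : seq T) :
  nc_eval (flatten (map F s)) = \sum_(u <- s) nc_eval (F u).
Proof. by rewrite /nc_eval big_flatten big_map. Qed.

Lemma nc_eval_wmul u p v :
  nc_eval (nc_wmul u p v) = word_eval u * nc_eval p * word_eval v.
Proof.
rewrite /nc_eval big_map mulr_sumr mulr_suml; apply: eq_bigr => t _.
by rewrite /word_eval /= !big_cat /= mulrA -scalerAr -scalerAl.
Qed.

Lemma nc_eval_insert t p : nc_eval (nc_insert t p) = nc_eval (t :: p).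
Proof.
elim: p => //= u p IH; case: eqP => [tu|_].
  by rewrite !nc_eval_cons eis_evalD tu scalerDl addrA.
by rewrite nc_eval_cons IH !nc_eval_cons addrCA.
Qed.

Lemma nc_eval_collect p : nc_eval (nc_collect p) = nc_eval p.
Proof. by elim: p => //= t p IH; rewrite nc_eval_insert !nc_eval_cons IH. Qed.

Lemma nc_eval_zero p : nc_zero p -> nc_eval p = 0.
Proof.
move=> p0; rewrite /nc_eval big_seq big1 // => t /(allP p0) /andP[/eqP t1 /eqP t2].
by rewrite /eis_eval t1 t2 mul0r addr0 scale0r.
Qed.

Hypothesis b_omega : b ^+ 2 + b + 1 = 0.

Lemma eis_evalM u v : eis_eval (eis_mul u v) = eis_eval u * eis_eval v.
Proof.
rewrite /eis_eval /= !rmorphB /= !rmorphD /= !rmorphM /=.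
set p := u.1%:~R; set q := u.2%:~R; set r := v.1%:~R; set s := v.2%:~R.
apply/eqP; rewrite -subr_eq0; apply/eqP.
transitivity (- (q * s) * (b ^+ 2 + b + 1)); first by ring.
by rewrite b_omega mulr0.
Qed.

Lemma nc_eval_scale c p : nc_eval (nc_scale c p) = eis_eval c *: nc_eval p.
Proof.
rewrite /nc_eval big_map scaler_sumr; apply: eq_bigr => t _.
by rewrite eis_evalM scalerA.
Qed.

Definition sound (rs : rewrite_rules) : Prop :=
  forall r, r \in rs -> word_eval r.1 = nc_eval r.2.

Variable rs : rewrite_rules.
Hypothesis rs_sound : sound rs.

Lemma rewrite_headP w p : rewrite_head rs w = Some p -> nc_eval p = word_eval w.
Proof.
elim: rs rs_sound => //= -[l q] rs' IH rsS.
case: ifP => [/prefixP [w' ->] [<-]|_]; last first.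
  by apply: IH => r r_in; apply: rsS; rewrite inE r_in orbT.
rewrite drop_size_cat // nc_eval_wmul -(rsS (l, q)) ?mem_head //=.
by rewrite /word_eval big_nil mul1r big_cat.
Qed.

Lemma rewrite_wordP w p : rewrite_word rs w = Some p -> nc_eval p = word_eval w.
Proof.
elim: w p => [|i w IH] p /=.
  by case E: rewrite_head => [q|] // [<-]; apply: rewrite_headP.
case E: rewrite_head => [q|]; first by move=> [<-]; apply: rewrite_headP.
case: rewrite_word IH => // q IH [<-]; rewrite nc_eval_wmul (IH q) //.
by rewrite /word_eval !big_cons !big_nil !mulr1.
Qed.

Lemma normal_formP n t : nc_eval (normal_form rs n t) = nc_eval [:: t].
Proof.
elim: n t => //= n IH t; case E: rewrite_word => [p|] //.
rewrite nc_eval_flatten; under eq_bigr do rewrite IH.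
rewrite nc_eval_cons nc_eval_nil addr0 -(rewrite_wordP E) -nc_eval_scale.
by rewrite /nc_eval; apply: eq_bigr => u _; rewrite big_seq1.
Qed.

Lemma nc_normalP p : nc_eval (nc_normal rs p) = nc_eval p.
Proof.
rewrite nc_eval_collect nc_eval_flatten; apply: eq_bigr => t _.
by rewrite normal_formP nc_eval_cons nc_eval_nil addr0.
Qed.

(** Every rewriting step replaces equals by equals in [A], whether or not the
    rules terminate or are confluent: a successful run of [nc_eq] proves the
    equality. *)
Lemma nc_eqP p q : nc_eq rs p q -> nc_eval p = nc_eval q.
Proof.
move=> /nc_eval_zero; rewrite nc_normalP nc_eval_cat nc_eval_scale.
by rewrite eis_eval_int scaleN1r => /subr0_eq.
Qed.

End Words.

Lemma eq_nc_eval (A : algType K) (y z : nat -> A) n p :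
  nc_letters n p -> (forall i, (i < n)%N -> y i = z i) ->
  nc_eval y p = nc_eval z p.
Proof.
move=> pn yz; rewrite /nc_eval big_seq [RHS]big_seq; apply: eq_bigr => t tp.
congr (_ *: _); rewrite /word_eval big_seq [RHS]big_seq; apply: eq_bigr => i it.
by apply: yz; move/allP: (allP pn t tp) => /(_ i it).
Qed.

Lemma nc_eval_morph (A B : algType K) (f : {lrmorphism A -> B}) y p :
  f (nc_eval y p) = nc_eval (f \o y) p.
Proof.
rewrite /nc_eval linear_sum; apply: eq_bigr => t _.
by rewrite linearZ /word_eval; congr (_ *: _); apply: rmorph_prod.
Qed.

End Evaluation.

(** * The relations and their tower *)

(** The defining relations are [x_j * x_i = kappa j i * x_i * x_j + tail j i] for
    [i < j], with the variables numbered from [0]. In step [j] of the tower,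
    [sigma] scales [x_i] by [kappa j i] and [delta] sends it to [tail j i]. *)
Definition kappa (j i : nat) : eisenstein :=
  match j, i with
  | 2, 1 | 3, 2 => (0, 1)
  | 3, 1 => (-1, -1)
  | 3, 0 | 4, 3 | 4, 0 => (1, 0)
  | _, _ => (-1, 0)
  end.

Definition tail (j i : nat) : nc_poly :=
  match j, i with
  | 2, 1 => [:: ((1, 0), [:: 0]%N)]
  | 3, 2 => [:: ((1, 0), [:: 1]%N)]
  | 4, 3 => [:: ((1, 0), [:: 2]%N)]
  | 4, 1 => [:: ((1, 1), [:: 2; 2]%N)]
  | 4, 0 => [:: ((0, -1), [:: 2; 2; 2]%N)]
  | _, _ => [::]
  end.

Definition rhs (j i : nat) : nc_poly := (kappa j i, [:: i; j]) :: tail j i.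

Definition lt_pairs (n : nat) : seq (nat * nat) :=
  [seq (j, i) | j <- iota 0 n, i <- iota 0 j].

Definition table_rules (n : nat) : rewrite_rules :=
  [seq ([:: ji.1; ji.2], rhs ji.1 ji.2) | ji <- lt_pairs n].

(** The endomorphism of step [n] is diagonal on the variables, so it multiplies a
    word by a scalar. *)
Definition sigma_scal (n : nat) (w : seq nat) : eisenstein :=
  foldr (fun i c => eis_mul (kappa n i) c) (1, 0) w.

(** The twisted Leibniz rule, unfolded along the word. *)
Fixpoint delta_word (n : nat) (w : seq nat) : nc_poly :=
  if w is i :: w' then
    nc_scale (kappa n i) (nc_wmul [:: i] (delta_word n w') [::]) ++
    nc_wmul [::] (tail n i) w'
  else [::].

Definition sigma_poly (n : nat) (p : nc_poly) : nc_poly :=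
  [seq (eis_mul t.1 (sigma_scal n t.2), t.2) | t <- p].

Definition delta_poly (n : nat) (p : nc_poly) : nc_poly :=
  flatten [seq nc_scale t.1 (delta_word n t.2) | t <- p].

(** For the endomorphism and the skew derivation of step [n], defined on words, to
    descend to the algebra of the earlier variables, both sides of each relation
    must have equal images modulo all relations among these variables. *)
Definition skew_compatible (n : nat) (ji : nat * nat) : bool :=
  let lhs := [:: ((1, 0), [:: ji.1; ji.2])] in
  nc_eq (table_rules n) (sigma_poly n lhs) (sigma_poly n (rhs ji.1 ji.2)) &&
  nc_eq (table_rules n) (delta_poly n lhs) (delta_poly n (rhs ji.1 ji.2)).

Definition degrees : seq nat := [:: 5; 3; 2; 1; 1]%N.

Definition nc_homogeneous (d : seq nat) (m : nat) (p : nc_poly) : bool :=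
  all (fun t => sumn [seq nth 0%N d i | i <- t.2] == m) p.

Lemma table_compatible : all (fun n => all (skew_compatible n) (lt_pairs n)) (iota 0 5).
Proof. by vm_compute. Qed.

(** The sixth power condition is a convenient form of invertibility: all units
    of the ring of Eisenstein integers are sixth roots of unity. It makes the
    endomorphism of each step an automorphism of order dividing six, hence
    injective. *)
Definition step_admissible (ji : nat * nat) : bool :=
  let: (j, i) := ji in
  [&& nc_letters j (tail j i),
      nc_homogeneous degrees (nth 0%N degrees j + nth 0%N degrees i) (tail j i) &
      iter 6 (eis_mul (kappa j i)) (1, 0) == (1, 0)].

Lemma table_admissible : all step_admissible (lt_pairs 5).
Proof. by vm_compute. Qed.

Section Tower.
Variables (K : fieldType) (b : K).
Hypothesis b_omega : b ^+ 2 + b + 1 = 0.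

Definition satisfies (A : algType K) (n : nat) (y : nat -> A) : Prop :=
  forall j i, (i < j)%N -> (j < n)%N -> y j * y i = nc_eval b y (rhs j i).

(** [A] has the universal property of the algebra with generators
    [y 0, ..., y n.-1] and the first relations of the table. *)
Definition presented (A : algType K) (n : nat) (y : nat -> A) : Prop :=
  satisfies n y /\
  forall (B : algType K) (z : nat -> B), satisfies n z ->
    exists f : {lrmorphism A -> B}, forall i, (i < n)%N -> f (y i) = z i.

Lemma mem_lt_pairs n j i : ((j, i) \in lt_pairs n) = (i < j < n)%N.
Proof.
apply/allpairsPdep/andP => [[j' [i' [+ + [-> ->]]]]|[ij jn]].
  by rewrite !mem_iota.
by exists j, i; rewrite !mem_iota.
Qed.

Lemma satisfies_sound (A : algType K) n (y : nat -> A) :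
  satisfies n y -> sound b y (table_rules n).
Proof.
move=> yP _ /mapP[[j i] + ->] /=; rewrite mem_lt_pairs => /andP[ij jn].
by rewrite -yP // !word_eval_cons word_eval_nil mulr1.
Qed.

Section TriangularImages.
Variables (A : algType K) (y : nat -> A) (n : nat).

(** The images of the variables under the morphism
    [r |-> (sigma r, delta r, r)] that encodes step [n]. *)
Definition tri_image (i : nat) : tri A :=
  (eis_eval b (kappa n i) *: y i, nc_eval b y (tail n i), y i).

Lemma word_eval_tri w : word_eval tri_image w =
  (eis_eval b (sigma_scal n w) *: word_eval y w,
   nc_eval b y (delta_word n w), word_eval y w).
Proof.
elim: w => [|i w IH].
  by rewrite !word_eval_nil nc_eval_nil eis_eval_int scale1r.
rewrite !word_eval_cons IH; apply: tri_eq => //=.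
  by rewrite (eis_evalM b_omega) -scalerAl -scalerAr scalerA.
rewrite nc_eval_cat (nc_eval_scale _ b_omega) !nc_eval_wmul.
by rewrite word_eval_cons !word_eval_nil !mulr1 mul1r -scalerAl.
Qed.

Lemma nc_eval_tri p : nc_eval b tri_image p =
  (nc_eval b y (sigma_poly n p), nc_eval b y (delta_poly n p), nc_eval b y p).
Proof.
elim: p => [|[c w] p IH]; first by rewrite !nc_eval_nil.
rewrite !nc_eval_cons IH word_eval_tri; apply: tri_eq => //=.
  by rewrite scalerA -(eis_evalM b_omega).
by rewrite nc_eval_cat (nc_eval_scale _ b_omega).
Qed.

Lemma satisfies_tri :
  all (skew_compatible n) (lt_pairs n) -> satisfies n y -> satisfies n tri_image.
Proof.
move=> /allP compat yP j i ij jn.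
have /compat /andP[sE dE] : (j, i) \in lt_pairs n by rewrite mem_lt_pairs ij.
have yS := satisfies_sound yP.
rewrite -(nc_eval_pair b tri_image) !nc_eval_tri.
rewrite (nc_eqP b_omega yS sE) (nc_eqP b_omega yS dE).
by rewrite nc_eval_pair yP.
Qed.

End TriangularImages.

Lemma mem_zipP (A : eqType) (x0 : A) (s : seq A) (d : seq nat) v :
  (size s <= size d)%N ->
  reflect (exists2 i, (i < size s)%N & v = (nth x0 s i, nth 0%N d i))
          (v \in zip s d).
Proof.
move=> sd; have sz : size (zip s d) = size s by rewrite size_zip (minn_idPl sd).
apply: (iffP (nthP (x0, 0%N))); rewrite sz => -[i i_s].
  by rewrite nth_zip_cond sz i_s => <-; exists i.
by move=> ->; exists i; rewrite // nth_zip_cond sz i_s.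
Qed.

Lemma hcomp_nc_eval (A : algType K) (g : seq (A * nat)) (y : nat -> A)
    (d : seq nat) (n : nat) p m :
  (forall i, (i < n)%N -> hcomp g (nth 0%N d i) (y i)) ->
  nc_letters n p -> nc_homogeneous d m p -> hcomp g m (nc_eval b y p).
Proof.
move=> gy pn pm; rewrite /nc_eval big_seq; apply: submod_sum => [|t tp].
  exact: hcomp_submod.
apply: (submodZ _ (hcomp_submod _ _)); rewrite -(eqP (allP pm t tp)).
move: (allP pn t tp); elim: t.2 => [_|i w IH /= /andP[i_n wn]].
  by rewrite word_eval_nil; apply: hcomp_1.
by rewrite word_eval_cons; apply: hcompM; [exact: gy | exact: IH].
Qed.

Lemma lrmorphism_iter (A : algType K) (s : {lrmorphism A -> A}) k :
  exists f : {lrmorphism A -> A}, f =1 iter k s.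
Proof.
elim: k => [|k [f fE]]; first by exists idfun.
by exists (s \o f) => u /=; rewrite fE.
Qed.

Lemma table_step j i : (i < j < 5)%N ->
  [/\ nc_letters j (tail j i),
      nc_homogeneous degrees (nth 0%N degrees j + nth 0%N degrees i) (tail j i) &
      eis_eval b (kappa j i) ^+ 6 = 1].
Proof.
rewrite -mem_lt_pairs => /(allP table_admissible) /and3P[? ? /eqP kap6]; split=> //.
rewrite -[RHS](eis_eval_int b 1) -kap6.
by rewrite /= !(eis_evalM b_omega) eis_eval_int mulr1 !exprS expr0 mulr1.
Qed.

Lemma nc_lettersW m n p : (m <= n)%N -> nc_letters m p -> nc_letters n p.
Proof.
move=> mn; apply: sub_all => t; apply: sub_all => i im.
exact: leq_trans im mn.
Qed.

Lemma nc_eval_rhs (A : algType K) (y : nat -> A) j i :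
  nc_eval b y (rhs j i) =
    eis_eval b (kappa j i) *: (y i * y j) + nc_eval b y (tail j i).
Proof. by rewrite nc_eval_cons !word_eval_cons word_eval_nil mulr1. Qed.

(** The universal property of the tower built so far turns [satisfies_tri] into a
    morphism to triangular matrices, whose entries are the [sigma] and [delta]
    of the next step. The universal property of the extension then combines
    with the one of [R] to present [S] by one more generator and the relations
    that involve it. *)
Lemma ore_step n (R : algType K) (T : ore_tower R) :
  (n < 5)%N -> size (ore_vars T) = n ->
  presented n (nth 0 (ore_vars T)) -> ore_graded degrees T -> ore_injective T ->
  exists (S : algType K) (T' : ore_tower S),
    [/\ size (ore_vars T') = n.+1, presented n.+1 (nth 0 (ore_vars T')),
        ore_graded degrees T' & ore_injective T'].
Proof.
move=> n5; set vs := ore_vars T => sT [yP univ] gT iT.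
set y := nth 0 vs in yP univ.
have n_in : n \in iota 0 5 by rewrite mem_iota.
have step_n i : (i < n)%N -> (i < n < 5)%N by move->.
have [f fE] := univ _ _ (satisfies_tri (allP table_compatible n n_in) yP).
have [s [t [d [fsdt dM]]]] := tri_skew f.
have sE i : (i < n)%N -> s (y i) = eis_eval b (kappa n i) *: y i.
  by move=> /fE; rewrite fsdt => -[].
have dE i : (i < n)%N -> d (y i) = nc_eval b y (tail n i).
  by move=> /fE; rewrite fsdt => -[].
have vsP v : v \in vs -> exists2 i, (i < n)%N & v = y i.
  by move=> /(nthP (0 : R)) -[i + <-]; rewrite sT; exists i.
have tE : t =1 idfun.
  apply: (ore_tower_eq (T := T)) => v /vsP[i i_n ->].
  by have := fE i i_n; rewrite fsdt => -[].
have {}dM r1 r2 : d (r1 * r2) = s r1 * d r2 + d r1 * r2 by rewrite dM tE.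
have [S [iota [x oreS]]] := ore_ext_exists dM.
have sd : (size vs <= size degrees)%N by rewrite sT ltnW.
exists S, (OreStep T oreS).
have -> : ore_vars (OreStep T oreS) = rcons (map iota vs) x by [].
split.
- by rewrite size_rcons size_map sT.
(* The new relations hold by the commutation rule of the extension; the old ones
  are transported along [iota]. *)
- set y' := nth 0 _.
  have y'E i : (i < n)%N -> y' i = iota (y i).
    by move=> i_n; rewrite /y' nth_rcons size_map sT i_n (nth_map 0) ?sT.
  have y'n : y' n = x by rewrite /y' nth_rcons size_map sT ltnn eqxx.
  have iota_eval p : nc_letters n p -> iota (nc_eval b y p) = nc_eval b y' p.
    move=> pn; rewrite nc_eval_morph; apply/esym.
    exact: (eq_nc_eval b pn y'E).
  split=> [j i ij|B z zP].
    rewrite ltnS leq_eqVlt => /predU1P[jn|jn].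
      rewrite {j}jn in ij *; have [tl _ _] := table_step (step_n i ij).
      rewrite nc_eval_rhs y'n y'E // (ore_ext_comm oreS) sE // dE //.
      by rewrite iota_eval // linearZ /= scalerAl.
    have i_n := ltn_trans ij jn.
    have [|tl _ _] := @table_step j i; first by rewrite ij (ltn_trans jn n5).
    rewrite !y'E // -rmorphM /= yP // iota_eval //=.
    by rewrite /nc_letters /= i_n jn; apply: nc_lettersW tl; apply: ltnW.
  have {univ} [|g gE] := univ B z.
    by move=> j i ij jn; apply: zP => //; apply: ltnW.
  have [|h [hiota hx]] := ore_lift oreS (f := g) (y := z n).
    apply: (skew_comm_gen (T := T) dM) => v /vsP[i i_n ->].
    rewrite sE // dE // gE // zP // nc_eval_rhs linearZ /= gE // scalerAl.
    have [tl _ _] := table_step (step_n i i_n).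
    by rewrite nc_eval_morph (eq_nc_eval b tl gE).
  exists h => i; rewrite ltnS leq_eqVlt => /predU1P[->|i_n].
    by rewrite y'n hx.
  by rewrite y'E // hiota gE.
- split=> // [|v /(mem_zipP (0 : R) _ sd) -[i + ->]].
    by rewrite sT; move: (n) n5; do 5!case=> //.
  rewrite sT => i_n {v}.
  have [tl th _] := table_step (step_n i i_n).
  have gy k : (k < n)%N -> hcomp (zip vs degrees) (nth 0%N degrees k) (y k).
    move=> k_n; have vg : (y k, nth 0%N degrees k) \in zip vs degrees.
      by apply/(mem_zipP (0 : R) _ sd); exists k; rewrite ?sT.
    exact: (hcomp_gen vg).
  rewrite -/(y i) sE // dE //; split.
    by apply: (submodZ _ (hcomp_submod _ _)); apply: gy.
  exact: hcomp_nc_eval gy tl th.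
(* The sixth iterate of [s] fixes every variable. *)
- split=> //; have [s6 s6E] := lrmorphism_iter s 6.
  have s6_id : s6 =1 idfun.
    apply: (ore_tower_eq (T := T)) => v /vsP[i i_n ->].
    have [_ _ k6] := table_step (step_n i i_n).
    have itE k : iter k s (y i) = eis_eval b (kappa n i) ^+ k *: y i.
      elim: k => [|k IH]; first by rewrite expr0 scale1r.
      by rewrite iterS IH linearZ /= sE // scalerA exprSr.
    by rewrite s6E itE k6 scale1r.
  move=> u v suv; rewrite -[u]s6_id -[v]s6_id !s6E.
  by rewrite !iterSr suv.
Qed.

Lemma ore_tower_exists : exists (A : algType K) (T : ore_tower A),
  [/\ size (ore_vars T) = 5, presented 5 (nth 0 (ore_vars T)),
      ore_graded degrees T & ore_injective T].
Proof.
suff: forall n, (n <= 5)%N -> exists (A : algType K) (T : ore_tower A),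
    [/\ size (ore_vars T) = n, presented n (nth 0 (ore_vars T)),
        ore_graded degrees T & ore_injective T] by apply.
elim=> [_|n IH n5]; last first.
  by have [A [T [sT pT gT iT]]] := IH (ltnW n5); apply: (ore_step n5 sT pT gT iT).
exists K^o, (OreBase K); split=> //; split=> // B z _.
have [|||f _] := @lrmorphism_exists K K^o B (fun k : K^o => k%:A).
- by move=> k u v /=; rewrite scalerDl scalerA.
- by rewrite scale1r.
- by move=> u v; rewrite mulr_algl scalerA.
by exists f.
Qed.

End Tower.

(** * The tower of the presented algebra *)
(** Only the last step is transported. A tower without variables has none, and
    its carrier has to be the base field. *)
Lemma ore_tower_iso (K : fieldType) (S A : algType K) (T : ore_tower S)
    (g : {lrmorphism S -> A}) :
  bijective g -> (0 < size (ore_vars T))%N ->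
  exists T' : ore_tower A,
    [/\ ore_vars T' = map g (ore_vars T),
        forall d, ore_graded d T -> ore_graded d T' &
        ore_injective T -> ore_injective T'].
Proof.
case: T g => [//|R {}S T iota x sigma delta oreS] g [g' gK g'K] _.
have oreA : is_ore_ext (g \o iota) (g x) sigma delta.
  case: oreS => deltaM comm ex; split=> // [r|a].
    by rewrite /= -!rmorphM comm rmorphD.
  have sumE (p : {poly R}) : \sum_(i < size p) (g \o iota) p`_i * g x ^+ i =
      g (\sum_(i < size p) iota p`_i * x ^+ i).
    by rewrite rmorph_sum; apply: eq_bigr => i _; rewrite rmorphM rmorphXn.
  have [p [pE p_uniq]] := ex (g' a); exists p; split.
    by rewrite sumE -pE g'K.
  by move=> q; rewrite sumE => aE; apply: p_uniq; rewrite aE gK.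
exists (OreStep T oreA); split=> //=.
by rewrite map_rcons -map_comp.
Qed.

Section Presentation.
Variables (K : fieldType) (b : K).
Hypothesis b_omega : b ^+ 2 + b + 1 = 0.

Local Notation F5 := (free_alg K 5).
Local Notation A := (quot_alg (ex_ideal b (- b))).

Definition free_var (i : nat) : F5 := free_gen K (inord i).

Definition table_relation (B : algType K) (y : nat -> B) (j i : nat) : B :=
  y j * y i - nc_eval b y (rhs j i).

Lemma table_relation_morph (B C : algType K) (f : {lrmorphism B -> C}) y j i :
  f (table_relation y j i) = table_relation (f \o y) j i.
Proof. by rewrite rmorphB rmorphM /= nc_eval_morph. Qed.

(** The order in which the ten relations of [A] are listed. *)
Definition table_pairs : seq (nat * nat) :=
  [:: (1, 0); (2, 1); (2, 0); (3, 2); (3, 1); (3, 0);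
      (4, 3); (4, 2); (4, 1); (4, 0)]%N.

Lemma table_relationsE (B : algType K) (y : nat -> B) :
  [seq table_relation y ji.1 ji.2 | ji <- table_pairs] =
  [:: y 1%N * y 0%N - (- (y 0%N * y 1%N));
      y 2%N * y 1%N - (y 0%N + b *: (y 1%N * y 2%N));
      y 2%N * y 0%N - (- (y 0%N * y 2%N));
      y 3%N * y 2%N - (y 1%N + b *: (y 2%N * y 3%N));
      y 3%N * y 1%N - b ^+ 2 *: (y 1%N * y 3%N);
      y 3%N * y 0%N - y 0%N * y 3%N;
      y 4%N * y 3%N - (y 2%N + y 3%N * y 4%N);
      y 4%N * y 2%N - (- (y 2%N * y 4%N));
      y 4%N * y 1%N - (- (y 1%N * y 4%N) - b ^+ 2 *: (y 2%N * y 2%N));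
      y 4%N * y 0%N - (y 0%N * y 4%N + - b *: (y 2%N * y 2%N * y 2%N))].
Proof.
have e0 : eis_eval b (0, 1) = b by rewrite /eis_eval add0r mul1r.
have e1 : eis_eval b (0, -1) = - b by rewrite /eis_eval add0r mulN1r.
have e2 : eis_eval b (-1, -1) = b ^+ 2.
  rewrite /eis_eval /= mulN1r; apply/eqP; rewrite -subr_eq0; apply/eqP.
  by rewrite -[RHS]oppr0 -b_omega; ring.
have e3 : eis_eval b (1, 1) = - b ^+ 2.
  rewrite /eis_eval /= mul1r; apply/eqP; rewrite -subr_eq0; apply/eqP.
  by rewrite -[RHS]b_omega; ring.
have eN1 : eis_eval b (-1, 0) = -1 by rewrite eis_eval_int.
have eP1 : eis_eval b (1, 0) = 1 by rewrite eis_eval_int.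
rewrite [LHS]/= /table_relation !nc_eval_rhs.
congr [:: _; _; _; _; _; _; _; _; _; _]; congr (_ - _);
  rewrite [kappa _ _]/= [tail _ _]/= ?nc_eval_cons nc_eval_nil;
  rewrite ?word_eval_cons ?word_eval_nil ?addr0 ?mulr1 ?mulrA;
  rewrite ?eN1 ?eP1 ?e0 ?e1 ?e2 ?e3 ?scaleN1r ?scale1r ?scaleNr //.
all: by rewrite addrC.
Qed.

Lemma ex_relationsE :
  ex_relations b (- b) =
    [seq table_relation free_var ji.1 ji.2 | ji <- table_pairs].
Proof.
rewrite table_relationsE /ex_relations.
have varE k (k5 : (k < 5)%N) : free_gen K (Ordinal k5) = free_var k.
  by congr (free_gen K _); apply/val_inj; rewrite /= inordK.
by rewrite !varE.
Qed.

Lemma mem_table_pairs j i : (i < j < 5)%N -> (j, i) \in table_pairs.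
Proof. by move: j i => [|[|[|[|[|j]]]]] [|[|[|[|i]]]] //= /andP[]. Qed.

Lemma satisfiesP (B : algType K) (y : nat -> B) :
  satisfies b 5 y <->
  forall ji, ji \in table_pairs -> table_relation y ji.1 ji.2 = 0.
Proof.
split=> [yP [j i] ji|yP j i ij j5]; last first.
  by apply: subr0_eq; apply: (yP (j, i)); apply: mem_table_pairs; rewrite ij.
have pairs_lt : all (fun p => p.2 < p.1 < 5)%N table_pairs by [].
have /andP[ij j5] := allP pairs_lt _ ji.
by rewrite /table_relation yP // subrr.
Qed.

Lemma ex_ideal_ker (B : algType K) (f : {lrmorphism F5 -> B}) :
  satisfies b 5 (f \o free_var) ->
  ideal_set (ex_ideal b (- b)) `<=` [set u | f u = 0].
Proof.
move=> /satisfiesP fP; apply: ideal_gen_sub; first exact: ideal_closed_ker.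
move=> r /=; rewrite ex_relationsE => /mapP[ji ji_in ->].
by rewrite table_relation_morph fP.
Qed.

Definition ex_var (i : nat) : A := quot_pi (ex_ideal b (- b)) (free_var i).

Lemma ex_var_gen (B : algType K) (f g : {lrmorphism A -> B}) :
  (forall i, (i < 5)%N -> f (ex_var i) = g (ex_var i)) -> f =1 g.
Proof.
move=> fg; apply: quot_eq => i; have := fg i (ltn_ord i).
by rewrite /ex_var /free_var inord_val.
Qed.

Lemma eq_satisfies (B : algType K) (y z : nat -> B) :
  (forall i, (i < 5)%N -> y i = z i) -> satisfies b 5 y -> satisfies b 5 z.
Proof.
move=> yz yP j i ij j5; have i5 := ltn_trans ij j5.
have [|tl _ _] := @table_step _ _ b_omega j i; first by rewrite ij.
have rl : nc_letters 5 (rhs j i).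
  by rewrite /nc_letters /= i5 j5; apply: nc_lettersW tl; apply: ltnW.
by rewrite -!yz // yP // (eq_nc_eval b rl yz).
Qed.

Lemma ex_presented : presented b 5 ex_var.
Proof.
split=> [|B z zP].
  apply/satisfiesP => ji ji_in.
  rewrite -(table_relation_morph (quot_pi (ex_ideal b (- b)))).
  rewrite -(rmorph0 (quot_pi (ex_ideal b (- b)))).
  apply/quot_piP; rewrite subr0; apply: sub_ideal_gen => /=.
  by rewrite ex_relationsE; apply/mapP; exists ji.
have [f fE] := free_lift (fun i : 'I_5 => z i).
have fz i : (i < 5)%N -> (f \o free_var) i = z i.
  by move=> i5; rewrite /= /free_var fE inordK.
have [|g gE] := quot_lift (I := ex_ideal b (- b)) (f := f).
  by apply: ex_ideal_ker; apply: eq_satisfies zP => i /fz.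
by exists g => i i5; rewrite gE -fz.
Qed.

(** [A] and the abstract tower are presented by the same generators and
    relations, hence isomorphic. *)
Lemma ex_tower : exists T : ore_tower A,
  [/\ ore_vars T = mkseq ex_var 5, ore_graded degrees T & ore_injective T].
Proof.
have [S [T [sT [yP univ] gT iT]]] := ore_tower_exists b_omega.
set y := nth 0 (ore_vars T) in yP univ.
have [g gE] := univ _ _ ex_presented.1.
have [f fE] := ex_presented.2 _ _ yP.
have fg : cancel f g.
  apply: (ex_var_gen (f := g \o f) (g := idfun)) => i i5 /=.
  by rewrite fE // gE.
have gf : cancel g f.
  apply: (ore_tower_eq (T := T) (f := f \o g) (g := idfun)) => v vT /=.
  have [i i5 <-] := nthP 0 vT; rewrite sT in i5.
  by rewrite -/(y i) gE // fE.
have [||T' [vT' gT' iT']] := @ore_tower_iso _ _ _ T g.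
- by exists f.
- by rewrite sT.
exists T'; split; [|exact: gT'|exact: iT'].
rewrite vT'; apply: (@eq_from_nth _ 0); rewrite size_map sT ?size_mkseq //.
by move=> i i5; rewrite (nth_map 0) ?sT // nth_mkseq // -/(y i) gE.
Qed.

Lemma ex_var_seq :
  [seq quot_pi (ex_ideal b (- b)) (free_gen K i) | i <- enum 'I_5] =
    mkseq ex_var 5.
Proof.
apply: (@eq_from_nth _ 0); rewrite size_map size_enum_ord ?size_mkseq //.
move=> i i5; rewrite (nth_map (inord i)) ?size_enum_ord // nth_mkseq //.
congr (quot_pi _ (free_gen K _)); apply/val_inj.
by rewrite /= nth_enum_ord // inordK.
Qed.

(** * Two generators and three relations *)
(** The relations for [x3 x2], [x4 x3] and [x5 x4] express [x1], [x2] and [x3] as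
    twisted commutators, so all five variables are iterated brackets of
    [u = x4] and [v = x5]. *)
Definition gen_env (B : algType K) (u v : B) (i : nat) : B :=
  let x3 := v * u - u * v in
  let x2 := u * x3 - b *: (x3 * u) in
  let x1 := x3 * x2 - b *: (x2 * x3) in
  nth 0 [:: x1; x2; x3; u; v] i.

Lemma satisfies_gen_env (B : algType K) (z : nat -> B) : satisfies b 5 z ->
  forall i, (i < 5)%N -> z i = gen_env (z 3%N) (z 4%N) i.
Proof.
move=> /satisfiesP zP.
have := table_relationsE z.
have -> : [seq table_relation z ji.1 ji.2 | ji <- table_pairs] =
    [seq 0 | ji <- table_pairs] by apply/eq_in_map => ji /zP.
move=> [_ r21 _ r32 _ _ r43 _ _ _].
have z2 : z 2%N = z 4%N * z 3%N - z 3%N * z 4%N.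
  by rewrite (subr0_eq (esym r43)) addrK.
have z1 : z 1%N = z 3%N * z 2%N - b *: (z 2%N * z 3%N).
  by rewrite (subr0_eq (esym r32)) addrK.
have z0 : z 0%N = z 2%N * z 1%N - b *: (z 1%N * z 2%N).
  by rewrite (subr0_eq (esym r21)) addrK.
by rewrite /gen_env -z2 -z1 -z0 => -[|[|[|[|[|]]]]].
Qed.

Lemma gen_env_morph (B C : algType K) (f : {lrmorphism B -> C}) u v i :
  f (gen_env u v i) = gen_env (f u) (f v) i.
Proof.
have f3 : f (v * u - u * v) = f v * f u - f u * f v.
  by rewrite rmorphB !rmorphM.
have fb p q : f (p * q - b *: (q * p)) = f p * f q - b *: (f q * f p).
  by rewrite linearB linearZ !rmorphM.
case: i => [|[|[|[|[|i]]]]]; rewrite /gen_env /= ?fb ?f3 //.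
by rewrite !nth_nil rmorph0.
Qed.

Lemma gen_env_closed (B : algType K) (S : set B) (u v : B) :
  (forall s t, S s -> S t -> S (s - t)) ->
  (forall s t, S s -> S t -> S (s * t)) ->
  (forall k s, S s -> S (k *: s)) ->
  S u -> S v -> forall i, (i < 5)%N -> S (gen_env u v i).
Proof.
move=> SB SM SZ Su Sv.
have bracket s t : S s -> S t -> S (s * t - b *: (t * s)).
  by move=> Ss St; apply: SB; [|apply: SZ]; apply: SM.
have S2 : S (v * u - u * v) by apply: SB; apply: SM.
have S1 := bracket _ _ Su S2; have S0 := bracket _ _ S2 S1.
by move=> [|[|[|[|[|i]]]]].
Qed.

Lemma sound_nil (B : algType K) (y : nat -> B) : sound b y [::].
Proof. by []. Qed.

Lemma sound_cons (B : algType K) (y : nat -> B) l p rs :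
  word_eval y l = nc_eval b y p -> sound b y rs -> sound b y ((l, p) :: rs).
Proof. by move=> lp rsS r; rewrite inE => /predU1P [->|/rsS]. Qed.

(** One level of the definition of the three derived variables, as a rewriting
    rule. [letter_rules] expands every polynomial into the letters [3] and
    [4]. *)
Definition letter_poly (i : nat) : nc_poly :=
  match i with
  | 0 => [:: ((1, 0), [:: 2; 1]%N); ((0, -1), [:: 1; 2]%N)]
  | 1 => [:: ((1, 0), [:: 3; 2]%N); ((0, -1), [:: 2; 3]%N)]
  | _ => [:: ((1, 0), [:: 4; 3]%N); ((-1, 0), [:: 3; 4]%N)]
  end.

Definition letter_rules : rewrite_rules :=
  [seq ([:: i], letter_poly i) | i <- iota 0 3].

Lemma gen_env_letters (B : algType K) (u v : B) :
  sound b (gen_env u v) letter_rules.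
Proof.
have sN1 : eis_eval b (0, -1) = - b by rewrite /eis_eval add0r mulN1r.
have s1 : eis_eval b (1, 0) = 1 by rewrite eis_eval_int.
have s1' : eis_eval b (-1, 0) = -1 by rewrite eis_eval_int.
do !apply: sound_cons; last exact: sound_nil.
all: rewrite !nc_eval_cons nc_eval_nil !word_eval_cons !word_eval_nil.
all: by rewrite !mulr1 addr0 ?sN1 ?s1' s1 scale1r ?scaleNr ?scale1r.
Qed.

(** The ten relations follow from three. Those for [x5 x4], [x4 x3] and [x3 x2]
    hold by definition of the brackets. Expanding [x2] as a bracket and
    reordering gives the one for [x5 x2]; expanding [x1] gives those for
    [x4 x1] and [x5 x1]. The one for [x2 x1] comes from the overlap of [x4 x3]
    with [x3 x1]. *)
Lemma gen_env_satisfies (B : algType K) (u v : B) (y := gen_env u v) :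
  y 4%N * y 2%N = nc_eval b y (rhs 4 2) ->
  y 3%N * y 1%N = nc_eval b y (rhs 3 1) ->
  y 2%N * y 0%N = nc_eval b y (rhs 2 0) ->
  satisfies b 5 y.
Proof.
pose holds j i := word_eval y [:: j; i] = nc_eval b y (rhs j i).
have holdsE j i : holds j i <-> y j * y i = nc_eval b y (rhs j i).
  by rewrite /holds !word_eval_cons word_eval_nil mulr1.
move=> /holdsE r42 /holdsE r31 /holdsE r20.
have s1 : eis_eval b (1, 0) = 1 by rewrite eis_eval_int.
have sb : eis_eval b (0, 1) = b by rewrite /eis_eval add0r mul1r.
have y_letter i : (i < 3)%N -> word_eval y [:: i] = nc_eval b y (letter_poly i).
  move=> i3; have /= := @gen_env_letters B u v ([:: i], letter_poly i); apply.
  by apply/mapP; exists i; rewrite ?mem_iota.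
have r43 : holds 4%N 3%N.
  apply/holdsE; rewrite nc_eval_rhs nc_eval_cons nc_eval_nil word_eval_cons.
  by rewrite word_eval_nil mulr1 addr0 s1 !scale1r addrC subrK.
have r32 : holds 3%N 2%N.
  apply/holdsE; rewrite nc_eval_rhs nc_eval_cons nc_eval_nil word_eval_cons.
  by rewrite word_eval_nil mulr1 addr0 s1 sb scale1r addrC subrK.
have r21 : holds 2%N 1%N.
  apply/holdsE; rewrite nc_eval_rhs nc_eval_cons nc_eval_nil word_eval_cons.
  by rewrite word_eval_nil mulr1 addr0 s1 sb scale1r addrC subrK.
have derive rs j i : sound b y rs ->
    nc_eq rs [:: ((1, 0), [:: j; i])] (rhs j i) -> holds j i.
  by move=> rsS /(nc_eqP b_omega rsS); rewrite nc_eval_pair => /holdsE.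
have r41 : holds 4%N 1%N.
  apply: (derive [:: ([:: 1%N], letter_poly 1); ([:: 4; 3]%N, rhs 4 3);
                     ([:: 4; 2]%N, rhs 4 2)]); last by vm_compute.
  by do !apply: sound_cons => //; apply: y_letter.
have r30 : holds 3%N 0%N.
  apply: (derive [:: ([:: 0%N], letter_poly 0); ([:: 3; 2]%N, rhs 3 2);
                     ([:: 3; 1]%N, rhs 3 1)]); last by vm_compute.
  by do !apply: sound_cons => //; apply: y_letter.
have r40 : holds 4%N 0%N.
  apply: (derive [:: ([:: 0%N], letter_poly 0); ([:: 4; 2]%N, rhs 4 2);
                     ([:: 4; 1]%N, rhs 4 1)]); last by vm_compute.
  by do !apply: sound_cons => //; apply: y_letter.
have r10 : holds 1%N 0%N.
  pose rs : rewrite_rules := [:: ([:: 3; 2]%N, rhs 3 2); ([:: 3; 0]%N, rhs 3 0);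
                                 ([:: 2; 0]%N, rhs 2 0)].
  have rsS : sound b y rs by do !apply: sound_cons => //; apply: sound_nil.
  pose p : nc_poly := [:: ((1, 0), [:: 1; 0]%N); ((1, 0), [:: 0; 1]%N)].
  (* Left multiplication of [x3 x1 + x1 x3 = 0] by [x4]; after reordering, what
     remains is [x2 x1 + x1 x2]. *)
  pose q : nc_poly := [:: ((1, 0), [:: 3; 2; 0]%N); ((1, 0), [:: 3; 0; 2]%N)].
  have /(nc_eqP b_omega rsS) : nc_eq rs p q by vm_compute.
  have /holdsE := r20; rewrite nc_eval_rhs nc_eval_nil addr0 eis_eval_int.
  rewrite scaleN1r => y20.
  rewrite !nc_eval_cons !nc_eval_nil !word_eval_cons !word_eval_nil !mulr1 !addr0.
  rewrite s1 !scale1r y20 mulrN addNr => /eqP; rewrite addr_eq0 => /eqP y10.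
  apply/holdsE; rewrite nc_eval_rhs nc_eval_nil addr0 eis_eval_int scaleN1r.
  exact: y10.
move=> j i ij j5; apply/holdsE.
by move: j i ij j5 => [|[|[|[|[|j]]]]] [|[|[|[|i]]]].
Qed.

(** The difference of the two sides of a relation, written out in the two
    generators. It is the list of its coefficients that matters here, not only
    its value. *)
Definition relation_poly (ji : nat * nat) : nc_poly :=
  nc_normal letter_rules
    (((1, 0), [:: ji.1; ji.2]) :: nc_scale (-1, 0) (rhs ji.1 ji.2)).

Lemma relation_polyE (B : algType K) (u v : B) ji :
  table_relation (gen_env u v) ji.1 ji.2 =
    nc_eval b (gen_env u v) (relation_poly ji).
Proof.
rewrite (nc_normalP b_omega (@gen_env_letters B u v)) -cat1s nc_eval_cat.
by rewrite nc_eval_pair (nc_eval_scale _ b_omega) eis_eval_int scaleN1r.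
Qed.

End Presentation.

(** * Minimality of the three relations *)
Section RelationType.
Variables (K : fieldType) (b : K).
Hypothesis b_omega : b ^+ 2 + b + 1 = 0.

Local Notation F2 := (free_alg K 2).

Definition two_gen_env : nat -> F2 :=
  gen_env b (free_gen K ord0) (free_gen K ord_max).

(** The relations for [x5 x3], [x4 x2] and [x3 x1], of degrees [1 + 2], [1 + 3]
    and [2 + 5]. *)
Definition min_pairs : seq (nat * nat) := [:: (4, 2); (3, 1); (2, 0)]%N.

Definition min_relations : seq F2 :=
  [seq table_relation b two_gen_env ji.1 ji.2 | ji <- min_pairs].

(** The letters [3] and [4] of the computed polynomials are the generators of the
    free algebra on two letters. *)
Definition letter (k : nat) : 'I_2 := if k == 3%N then ord0 else ord_max.

(** The coefficient of the word [w], gathered from all terms of [p], since a word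
    may be repeated. *)
Definition coef_at (p : nc_poly) (w : seq 'I_2) : eisenstein :=
  foldr eis_add (0, 0) [seq t.1 | t <- p & map letter t.2 == w].

Definition in_two_letters (p : nc_poly) : bool :=
  all (fun t => all (fun k => (k == 3) || (k == 4))%N t.2) p.

Lemma word_eval_two_gen w : all (fun k => (k == 3) || (k == 4))%N w ->
  word_eval two_gen_env w = \prod_(i <- map letter w) free_gen K i.
Proof.
elim: w => [|k w IH] /=; first by rewrite word_eval_nil big_nil.
by move=> /andP[k34 /IH wE]; rewrite word_eval_cons big_cons wE;
  case/orP: k34 => /eqP ->.
Qed.

Lemma mcoeff_nc_eval p (m : {fmonom 'I_2}) : in_two_letters p ->
  (nc_eval b two_gen_env p)@_m = eis_eval b (coef_at p m).
Proof.
elim: p => [|t p IH] /=.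
  by rewrite nc_eval_nil mcoeff0 eis_eval_int.
move=> /andP[t34 /IH pE]; rewrite nc_eval_cons mcoeffD mcoeffZ pE.
rewrite word_eval_two_gen // mcoeff_free_monom /coef_at /=.
by case: eqP => _; rewrite ?mulr1 ?mulr0 ?add0r //= eis_evalD.
Qed.

(** This places [p] in the ideal of [infix_free_ideal]. Cancelled terms are kept
    in [p] with coefficient zero and do not count. *)
Definition misses (w : seq 'I_2) (p : nc_poly) : bool :=
  all (fun t => (t.1 == (0, 0)) || ~~ infix (map letter t.2) w) p.

Lemma coef_at_misses w p u : misses w p -> infix u w -> coef_at p u = (0, 0).
Proof.
move=> + uw; elim: p => //= t p IH /andP[tw /IH]; rewrite /coef_at /=.
case: eqP => // tu; rewrite /= => ->; case/orP: tw => [/eqP -> //|].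
by rewrite tu uw.
Qed.

(** With [x] for [x4] and [y] for [x5], these are the words [yyx], [xxxy] and
    [yxyxyxx]. The first two relations are [y^2 x - x y^2] and
    [y x^3 - x^3 y]; neither has a monomial that is a factor of the third word,
    at which the relation of degree [7] has an invertible coefficient. *)
Definition witness (k : nat) : seq 'I_2 :=
  map letter (nth [::] [:: [:: 4; 4; 3]; [:: 3; 3; 3; 4];
                           [:: 4; 3; 4; 3; 4; 3; 3]]%N k).

Lemma witness_check :
  all (fun k =>
    let q := relation_poly (nth (0, 0)%N min_pairs k) in
    in_two_letters q &&
    (iter 6 (eis_mul (coef_at q (witness k))) (1, 0) == (1, 0)) &&
    all (fun l => (l == k) ||
       misses (witness k) (relation_poly (nth (0, 0)%N min_pairs l)))
      (iota 0 3)) (iota 0 3).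
Proof. by vm_compute. Qed.

Lemma witnessP k : (k < 3)%N ->
  let q l := relation_poly (nth (0, 0)%N min_pairs l) in
  [/\ in_two_letters (q k), eis_eval b (coef_at (q k) (witness k)) != 0 &
      forall l, (l < 3)%N -> l != k ->
        in_two_letters (q l) /\ misses (witness k) (q l)].
Proof.
have in3 l : (l < 3)%N -> l \in iota 0 3 by rewrite mem_iota.
move=> k3 q; have two l : (l < 3)%N -> in_two_letters (q l).
  by move=> /in3 /(allP witness_check) /andP[/andP[]].
have /andP[/andP[_ /eqP coef6] /allP others] := allP witness_check k (in3 k k3).
split=> [||l l3 lk]; first exact: two.
  apply/negP => /eqP coef0.
  have := congr1 (eis_eval b) coef6.
  rewrite iterS (eis_evalM b_omega) coef0 mul0r eis_eval_int => /esym/eqP.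
  by rewrite oner_eq0.
split; first exact: two.
by have /orP[/idPn|] := others l (in3 l l3).
Qed.

Local Notation mrel k := (nth 0 min_relations k).

Lemma min_relationE k : (k < 3)%N ->
  mrel k = nc_eval b two_gen_env (relation_poly (nth (0, 0)%N min_pairs k)).
Proof.
by move=> k3; rewrite (nth_map (0, 0)%N) // (relation_polyE b_omega).
Qed.

Lemma min_relation_coef k : (k < 3)%N -> (mrel k)@_(FMonom (witness k)) != 0.
Proof.
move=> k3; have [two coefP _] := witnessP k3.
by rewrite min_relationE // mcoeff_nc_eval.
Qed.

Lemma min_relation_misses k l (m : {fmonom 'I_2}) : (k < 3)%N -> (l < 3)%N ->
  l != k -> infix m (witness k) -> (mrel l)@_m = 0.
Proof.
move=> k3 l3 lk mw; have [_ _ /(_ l l3 lk) [two miss]] := witnessP k3.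
by rewrite min_relationE // mcoeff_nc_eval // (coef_at_misses miss mw) eis_eval_int.
Qed.

Lemma min_relations_uniq : uniq min_relations.
Proof.
apply/(uniqP 0) => k l; rewrite !inE size_map => k3 l3 kl.
apply/eqP; apply: contraT => kNl; have := min_relation_coef k3.
rewrite kl (min_relation_misses (k := k)) ?eqxx ?(eq_sym l) //.
exact: infix_refl.
Qed.

(** If [G] omits a relation, all its members lie in the ideal of polynomials
    without monomials among the factors of the witness word of that relation,
    and the relation does not. *)
Lemma min_relations_irredundant (G : set F2) :
  G `<` [set` min_relations] -> ideal_gen G <> ideal_gen [set` min_relations].
Proof.
move=> [Gr rG] GE; apply: rG => r r_in; apply: contrapT => rNG.
have [k k3 rE] := nthP 0 r_in; rewrite size_map in k3.
have : ideal_gen G r by rewrite GE; apply: sub_ideal_gen.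
move=> /(ideal_gen_sub (infix_free_ideal K (witness k))) H.
have /eqP := min_relation_coef k3; apply; rewrite rE; apply: H; last exact: infix_refl.
move=> g Gg m mw /=; have [l l3 gE] := nthP 0 (Gr g Gg).
rewrite size_map in l3; rewrite -gE; apply: (min_relation_misses (k := k)) => //.
by apply/eqP => lk; apply: rNG; rewrite -rE -lk gE.
Qed.

Lemma gen_env_hcomp (B : algType K) (g : seq (B * nat)) (u v : B) :
  hcomp g 1 u -> hcomp g 1 v ->
  forall i, (i < 5)%N -> hcomp g (nth 0%N degrees i) (gen_env b u v i).
Proof.
move=> gu gv; have subP m := hcomp_submod g m.
have hB m x y : hcomp g m x -> hcomp g m y -> hcomp g m (x - y).
  move=> gx gy; rewrite -scaleN1r; apply: (submodD (subP m)) => //.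
  exact: (submodZ _ (subP m)).
have hb m x : hcomp g m x -> hcomp g m (b *: x).
  exact: (submodZ _ (subP m)).
have h2 : hcomp g 2 (v * u - u * v) by apply: hB; apply: (@hcompM _ _ _ 1 1).
set w := v * u - u * v in h2.
have h3 : hcomp g 3 (u * w - b *: (w * u)).
  by apply: hB; [|apply: hb]; [apply: (@hcompM _ _ _ 1 2) | apply: (@hcompM _ _ _ 2 1)].
set t := u * w - b *: (w * u) in h3.
have h5 : hcomp g 5 (w * t - b *: (t * w)).
  by apply: hB; [|apply: hb]; [apply: (@hcompM _ _ _ 2 3) | apply: (@hcompM _ _ _ 3 2)].
by move=> [|[|[|[|[|i]]]]].
Qed.

Lemma min_relations_degree i : (i < size min_relations)%N ->
  std_comp (nth 0%N [:: 3; 4; 7]%N i) (nth 0 min_relations i).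
Proof.
rewrite size_map => i3; rewrite (nth_map (0, 0)%N) // /std_comp.
set g := [seq (free_gen K i, 1%N) | i <- enum 'I_2].
have gP k : hcomp g 1 (free_gen K k).
  have kg : (free_gen K k, 1%N) \in g.
    by apply/mapP; exists k; rewrite ?mem_enum.
  exact: (hcomp_gen kg).
have yP := gen_env_hcomp (gP ord0) (gP ord_max).
have relP j k m : (k < j < 5)%N -> (nth 0 degrees j + nth 0 degrees k = m)%N ->
    hcomp g m (table_relation b two_gen_env j k).
  move=> kj <-; have [tl th _] := table_step b_omega kj.
  have /andP[k_j j5] := kj; have k5 := ltn_trans k_j j5.
  have hm := hcomp_submod g (nth 0 degrees j + nth 0 degrees k)%N.
  have yjk : hcomp g (nth 0 degrees j + nth 0 degrees k)%N
      (two_gen_env j * two_gen_env k).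
    by apply: hcompM; apply: yP.
  have rhsP : hcomp g (nth 0 degrees j + nth 0 degrees k)%N
      (nc_eval b two_gen_env (rhs j k)).
    apply: (hcomp_nc_eval (n := 5) b yP).
      rewrite /nc_letters /= k5 j5 /=.
      by apply: nc_lettersW tl; apply: ltnW.
    by rewrite /nc_homogeneous /= addn0 addnC eqxx.
  rewrite /table_relation -[X in _ + X]scaleN1r.
  by apply: (submodD hm) => //; apply: (submodZ _ hm).
by case: i i3 => [|[|[|i]]] // _; apply: relP.
Qed.

Local Notation A := (quot_alg (ex_ideal b (- b))).

(** The two generators map to [x4] and [x5]. In the quotient by the three
    relations, the iterated brackets satisfy all ten relations by
    [gen_env_satisfies], which gives the inverse morphism. *)
Lemma ex_relation_type (A_ : nat -> set A) :
  has_dim (A_ 1%N) 2 -> A_ 1%N (ex_var b 3) -> A_ 1%N (ex_var b 4) ->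
  relation_type A_ [:: 3; 4; 7]%N.
Proof.
move=> dimA A3 A4; split=> //.
have [yP univ] := ex_presented b_omega.
pose gen (k : 'I_2) := if k == ord0 then ex_var b 3 else ex_var b 4.
have [f fE] := free_lift gen.
have f_env i : (i < 5)%N -> f (two_gen_env i) = ex_var b i.
  move=> i5; rewrite /two_gen_env gen_env_morph !fE.
  exact/esym/(satisfies_gen_env b_omega yP).
have rel0 (B : algType K) (g : {lrmorphism F2 -> B}) :
    satisfies b 5 (g \o two_gen_env) ->
    ideal_gen [set` min_relations] `<=` [set u | g u = 0].
  move=> /satisfiesP gP; apply: ideal_gen_sub.
    exact: ideal_closed_ker.
  move=> r /= /mapP[ji ji_in ->]; rewrite table_relation_morph gP //.
  by move: ji ji_in; apply/allP.
have fI : ideal_gen [set` min_relations] `<=` [set u | f u = 0].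
  by apply: rel0; apply: (eq_satisfies b_omega) yP => i /f_env.
have I1 : ~ ideal_gen [set` min_relations] (1 : F2).
  move=> /fI f1; have /eqP := oner_neq0 A; apply.
  exact: etrans (esym (rmorph1 f)) f1.
pose I := Defs.ProperIdeal (ideal_gen_closed [set` min_relations]) I1.
have [psi psiE] := quot_lift (I := I) fI.
pose p k : quot_alg I := quot_pi I (free_gen K k).
pose z := gen_env b (p ord0) (p ord_max).
have zE i : z i = quot_pi I (two_gen_env i).
  by rewrite /z /two_gen_env gen_env_morph.
have rel_z ji : ji \in min_pairs -> z ji.1 * z ji.2 = nc_eval b z (rhs ji.1 ji.2).
  move=> ji_in; apply: subr0_eq.
  have -> : z ji.1 * z ji.2 - nc_eval b z (rhs ji.1 ji.2) =
      quot_pi I (table_relation b two_gen_env ji.1 ji.2).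
    rewrite table_relation_morph /table_relation.
    have -> : z = quot_pi I \o two_gen_env by apply/funext => i; apply: zE.
    by [].
  rewrite -(rmorph0 (quot_pi I)); apply/quot_piP; rewrite subr0.
  by apply: sub_ideal_gen; apply/mapP; exists ji.
have zP : satisfies b 5 z.
  by apply: (gen_env_satisfies b_omega); [apply: (rel_z (4, 2)%N) |
    apply: (rel_z (3, 1)%N) | apply: (rel_z (2, 0)%N)].
have [phi phiE] := univ _ _ zP.
have psi_gen k : psi (quot_pi I (free_gen K k)) = gen k by rewrite psiE fE.
exists 2, I, psi, min_relations; split=> //.
- exists phi => [u|a].
    apply: (quot_eq (f := phi \o psi) (g := idfun)) => k /=.
    rewrite psi_gen /gen; case: (unliftP ord0 k) => [k' ->|->] /=.
      by rewrite phiE // /z /= /p; congr (quot_pi _ (free_gen K _));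
        apply/val_inj; case: k' => [[]].
    by rewrite phiE.
  apply: (ex_var_gen (f := psi \o phi) (g := idfun)) => i i5 /=.
  by rewrite phiE // zE psiE f_env.
- by move=> k; rewrite psi_gen /gen; case: ifP.
split=> //.
- exact: min_relations_uniq.
- exact: min_relations_degree.
- exact: min_relations_irredundant.
Qed.

Lemma ex_generated (S : set A) :
  GRing.subalg_closed [in S] -> S (ex_var b 3) -> S (ex_var b 4) -> S = setT.
Proof.
move=> [S1 SL SM] S3 S4.
have SZ k u : S u -> S (k *: u).
  have S0 : S 0.
    have := SL (-1) 1 1 S1 S1; rewrite inE scaleN1r addNr; exact.
  by move=> Su; have := SL k u 0; rewrite !inE addr0; apply.
have SD u v : S u -> S v -> S (u + v).
  by move=> Su Sv; have := SL 1 u v; rewrite !inE scale1r; apply.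
have SM' u v : S u -> S v -> S (u * v).
  by move=> Su Sv; have := SM u v; rewrite !inE; apply.
have SB u v : S u -> S v -> S (u - v).
  by move=> Su Sv; rewrite -scaleN1r; apply: SD => //; apply: SZ.
have [T [vT _ _]] := ex_tower b_omega.
apply/seteqP; split=> // a _; apply: (ore_tower_gen (T := T) (P := S)) => //.
  by move=> k; apply: SZ; move: S1; rewrite inE.
move=> y; rewrite vT => /mapP -[i + ->]; rewrite mem_iota => i5.
rewrite (satisfies_gen_env b_omega (ex_presented b_omega).1 i5).
exact: (gen_env_closed b SB SM' SZ S3 S4 i5).
Qed.

End RelationType.

(** * The three claims for a primitive cube root of unity *)
(** The polynomial is [1 - 2 t] modulo [t^2]. *)
Lemma hilbert_function_degree1 (h : nat -> nat) :
  fps_eq_inv h ((1 - 'X) ^+ 2 * (1 - 'X^2) * (1 - 'X^3) * (1 - 'X^5)) ->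
  h 1%N = 2.
Proof.
set p : {poly int} := _ * (1 - 'X^5) => hP.
have [q pE] : exists q : {poly int}, p = 1 - 2%:P * 'X + 'X^2 * q.
  (* (1 - t^2)(1 - t^3)(1 - t^5) = 1 - t^2 (1 + t - t^5 - t^6 + t^8). *)
  exists (1 - (1 - 2%:P * 'X + 'X^2) * (1 + 'X - 'X^5 - 'X^6 + 'X^8)).
  by rewrite /p -[2%:P]/(2%:R%:P) polyC_natr; ring.
have p0 : p`_0 = 1.
  by rewrite pE coefD coefXnM coefB coefCM coefX coef1 mulr0 subr0 addr0.
have p1 : p`_1 = - 2.
  by rewrite pE coefD coefXnM coefB coefCM coefX coef1 mulr1 sub0r addr0.
have := hP 0%N; rewrite big_ord1 p0 mul1r => -[h0].
have := hP 1%N; rewrite big_ord_recl big_ord1 /= p0 p1 mul1r /bump /= h0 mulr1.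
by move=> /eqP; rewrite subr_eq0 => /eqP [].
Qed.

Section CubeRoot.
Variables (K : fieldType) (b : K).
Hypothesis b_omega : b ^+ 2 + b + 1 = 0.

Local Notation A := (quot_alg (ex_ideal b (- b))).
Local Notation x := (mkseq (ex_var b) 5).

Lemma ex_AS_ore_extension : AS_ore_extension (x : seq A) degrees.
Proof.
have [T [vT gT iT]] := ex_tower b_omega; exists T; split=> //.
have in_span i : (i < 5)%N -> nth 0%N degrees i = 1%N ->
    subalgebra_gen (hcomp (zip x degrees) 1) (ex_var b i).
  move=> i5 di S [_ GS]; apply: GS.
  have xg : (ex_var b i, 1%N) \in zip x degrees.
    apply/(mem_zipP (0 : A)); rewrite size_mkseq //; exists i => //.
    by rewrite nth_mkseq // di.
  exact: (hcomp_gen xg).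
apply: (ex_generated b_omega); [|exact: in_span|exact: in_span].
split=> [|k u v|u v]; rewrite !inE.
- by move=> S [[S1 _ _] _]; move: S1; rewrite inE.
- move=> Su Sv S SG; have [[_ SL _] _] := SG.
  by have := SL k u v; rewrite !inE; apply; [exact: Su | exact: Sv].
- move=> Su Sv S SG; have [[_ _ SM] _] := SG.
  by have := SM u v; rewrite !inE; apply; [exact: Su | exact: Sv].
Qed.

Lemma ex_hilbert_series :
  exists2 h : nat -> nat, hilbert_series (hcomp (zip (x : seq A) degrees)) h &
    fps_eq_inv h ((1 - 'X) ^+ 2 * (1 - 'X^2) * (1 - 'X^3) * (1 - 'X^5)).
Proof.
have [T [vT gT iT]] := ex_tower b_omega.
have sd : size degrees = size (ore_vars T) by rewrite vT.
have [_ [h dim_h hP]] := ore_tower_hilbert (eq_leq (esym sd)) gT.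
have gr := ore_tower_grading sd gT; rewrite vT in dim_h hP gr.
exists h; first by split.
suff -> : (1 - 'X) ^+ 2 * (1 - 'X^2) * (1 - 'X^3) * (1 - 'X^5) =
    \prod_(e <- take (size (x : seq A)) degrees) (1 - 'X^e) :> {poly int} by [].
rewrite size_mkseq /degrees !big_cons big_nil.
by ring.
Qed.

Lemma ex_cube_root :
  let d : seq nat := [:: 5; 3; 2; 1; 1]%N in
  let y : seq A :=
    [seq quot_pi (ex_ideal b (- b)) (free_gen K i) | i <- enum 'I_5] in
  let A_ := hcomp (zip y d) in
  [/\ AS_ore_extension y d,
      exists2 h : nat -> nat, hilbert_series A_ h &
        fps_eq_inv h ((1 - 'X) ^+ 2 * (1 - 'X^2) * (1 - 'X^3) * (1 - 'X^5)) &
      relation_type A_ [:: 3; 4; 7]%N].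
Proof.
rewrite ex_var_seq; split.
- exact: ex_AS_ore_extension.
- exact: ex_hilbert_series.
have [h [_ dim_h] hP] := ex_hilbert_series.
have in_A1 i : (i < 5)%N -> nth 0%N degrees i = 1%N ->
    hcomp (zip (x : seq A) degrees) 1 (ex_var b i).
  move=> i5 di; have xg : (ex_var b i, 1%N) \in zip x degrees.
    apply/(mem_zipP (0 : A)); rewrite size_mkseq //; exists i => //.
    by rewrite nth_mkseq // di.
  exact: (hcomp_gen xg).
apply: (ex_relation_type b_omega); [|exact: in_A1|exact: in_A1].
by have := dim_h 1%N; rewrite (hilbert_function_degree1 hP).
Qed.

End CubeRoot.

(** * The numbers b and c *)
(** The triple angle formula at [u = cos (pi / 3)] reads [4 u^3 - 3 u = -1], that
    is [(u + 1) (2 u - 1)^2 = 0], and [u] is positive. *)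
Lemma cos_pi3 (R : realType) : cos (pi / 3) = 1 / 2 :> R.
Proof.
set t : R := pi / 3; set u := cos t.
have u_gt0 : 0 < u.
  by apply: cos_gt0_pihalf; have := pi_gt0 R; rewrite /t; lra.
have piE : pi = t *+ 2 + t by rewrite /t; field.
have := cospi R; rewrite piE cosD cos_mulr2n sin_mulr2n -/u.
have -> : (u * sin t) *+ 2 * sin t = u * (1 - u ^+ 2) *+ 2.
  by rewrite -sin2cos2; ring.
move=> uE; have : (u + 1) * (2 * u - 1) ^+ 2 = 0.
  transitivity ((u ^+ 2 *+ 2 - 1) * u - u * (1 - u ^+ 2) *+ 2 + 1); first by ring.
  by rewrite uE addNr.
move=> /eqP; rewrite mulf_eq0 sqrf_eq0 => /orP[/eqP|/eqP]; first by lra.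
by lra.
Qed.

Lemma cexp_4pi3_omega (R : realType) (w := cexp (0 +i* (4 * pi / 3))%C : R[i]) :
  w ^+ 2 + w + 1 = 0.
Proof.
set t : R := 4 * pi / 3.
have tE : t = pi / 3 + pi by rewrite /t; field.
have c : cos t = - (1 / 2) by rewrite tE cosDpi cos_pi3.
have s2 : sin t ^+ 2 = 3 / 4 by rewrite sin2cos2 c; field.
rewrite /w /cexp -/t expR0 !mul1r c; apply/eqP; rewrite eq_complex expr2 /=.
apply/andP; split; apply/eqP.
  by move: s2; rewrite expr2; lra.
by field.
Qed.

(** Since [b^2 + b + 1 = 0], the denominator is [- 2 b]; this is where the
    characteristic must not be [2]. *)
Lemma omega_ratio (K : fieldType) (b : K) : b ^+ 2 + b + 1 = 0 -> 2 != 0 :> K ->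
  2 * b ^+ 2 / (1 - b + b ^+ 2) = - b.
Proof.
move=> b_omega two_neq0; have b_neq0 : b != 0.
  by apply: contra_eq_neq b_omega => ->; rewrite expr0n /= !add0r oner_neq0.
have dE : 1 - b + b ^+ 2 = - (2 * b).
  by apply: subr0_eq; rewrite -b_omega; ring.
have nE : 2 * b ^+ 2 = - b * (1 - b + b ^+ 2) by rewrite dE; ring.
by rewrite nE mulfK // dE oppr_eq0 mulf_neq0.
Qed.

Theorem theorem4p2 (R : realType) (K : fieldType) (iota : {rmorphism R[i] -> K}) :
  let b : K := iota (cexp (0 +i* (4 * pi / 3))%C) in
  let c : K := (2 * b ^+ 2) / (1 - b + b ^+ 2) in
  let A := quot_alg (ex_ideal b c) in
  let x : seq A := [seq quot_pi (ex_ideal b c) (free_gen K i) | i <- enum 'I_5] in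
  let d : seq nat := [:: 5; 3; 2; 1; 1]%N in
  let A_ := hcomp (zip x d) in
  [/\ AS_ore_extension x d,
      exists2 h : nat -> nat, hilbert_series A_ h &
        fps_eq_inv h ((1 - 'X) ^+ 2 * (1 - 'X^2) * (1 - 'X^3) * (1 - 'X^5)) &
      relation_type A_ [:: 3; 4; 7]%N].
Proof.
move=> b c.
have b_omega : b ^+ 2 + b + 1 = 0.
  by rewrite -(rmorph0 iota) -(cexp_4pi3_omega R) !rmorphD rmorphXn rmorph1.
have two_neq0 : 2 != 0 :> K.
  by rewrite -(rmorph_nat iota 2) fmorph_eq0 Num.Theory.pnatr_eq0.
rewrite /c (omega_ratio b_omega two_neq0).
exact: ex_cube_root b_omega.
Qed.
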